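(* For every integer $k\ge 3$ there exists $c_0>0$ such that for all $b,c\in(0,c_0)$ there exists $n_0$ such that for every $n\ge n_0$ with $k\mid n$ the following holds. If $G$ is a $k$-graph on $n$ vertices with $\delta(G) \ge (1/3+c)n$ and no perfect matching, then there is a partition of $V(G)$ into parts $V_1,V_2$, each of size at least $\delta(G)$, and $a \in \{0,1\}$ such that all but at most $bn^k$ edges $e$ of $G$ satisfy $|e \cap V_1| \equiv a \pmod 2$.
   Context: A $k$-graph $G$ is a set of $k$-element subsets (edges) of a vertex set $V(G)$. Its minimum degree $\delta(G)$ is the largest $m$ such that every set of $k-1$ vertices is contained in at least $m$ edges. A perfect matching is a set of pairwise disjoint edges covering all vertices. *)

(* Defs.v *)
From mathcomp Require Import all_boot all_order all_algebra.
From mathcomp Require Import reals.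
Set Implicit Arguments. Unset Strict Implicit. Unset Printing Implicit Defensive.

Definition is_kgraph (n k : nat) (G : {set {set 'I_n}}) : bool :=
  [forall e in G, #|e| == k].

Definition deg (n : nat) (G : {set {set 'I_n}}) (S : {set 'I_n}) : nat :=
  #|[set e in G | S \subset e]|.

(* Minimum (k-1)-degree: min over all (k-1)-sets S of deg S.
   (If there is no (k-1)-set, the value #|G| is returned; irrelevant for n >= k.) *)
Definition mindeg (n k : nat) (G : {set {set 'I_n}}) : nat :=
  \big[minn/#|G|]_(S : {set 'I_n} | #|S| == k.-1) deg G S.

Definition perfect_matching (n : nat) (G M : {set {set 'I_n}}) : bool :=
  (M \subset G) && trivIset M && (cover M == [set: 'I_n]).

Definition has_perfect_matching (n : nat) (G : {set {set 'I_n}}) : Prop :=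
  exists M, perfect_matching G M.

(* Main.v *)
(* Two vertices are linked when, avoiding any prescribed small set, there is a
   set W such that both x |: W and y |: W have perfect matchings.  Among any three
   vertices two have intersecting links, as 3 D > n; hence the vertices fall into
   at most two classes within which all pairs are linked.

   If edges with i and with i + 1 vertices in the class V are both unavoidable,
   the two classes merge.  Otherwise the codegree condition forces the edge types
   that survive the deletion of small sets to be exactly those of one parity a.

   In the merged case every leftover of constant size divisible by k is
   absorbable, and G has a perfect matching: reserve O(log n) disjoint edges such
   that every vertex can replace a vertex of many of them, reserve an absorber for
   each of the polylogarithmically many leftovers these exchanges can produce, and
   match greedily the rest up to fewer than 3 (k - 1) vertices.  In the parity case
   the same works for leftovers of the right parity; if some edge e0 has the wrong
   parity, releasing e0 corrects the leftover.  So without a perfect matching all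
   edges have parity a, with no exception at all. *)
Require Import Defs.
From mathcomp Require Import all_boot all_order all_algebra.
From mathcomp Require Import reals zify.
Set Implicit Arguments. Unset Strict Implicit. Unset Printing Implicit Defensive.

(** * Finite sets *)

Section SetAux.
Variable T : finType.
Implicit Types (A B C : {set T}) (z : T).

Lemma disjointE A B : [disjoint A & B] = [forall z, ~~ ((z \in A) && (z \in B))].
Proof.
apply/idP/forallP => [/disjointFr h z|h].
  by apply/negP => /andP[/h ->].
rewrite -setI_eq0 -subset0; apply/subsetP => z; rewrite inE => zAB.
by have := h z; rewrite zAB.
Qed.

Lemma disjoint_at A B : [disjoint A & B] -> forall z, ~~ ((z \in A) && (z \in B)).
Proof. by rewrite disjointE => /forallP. Qed.

Lemma subset_at A B : A \subset B -> forall z, (z \in A) ==> (z \in B).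
Proof. by move=> /subsetP h z; apply/implyP/h. Qed.

Lemma leq_cardU A B : #|A :|: B| <= #|A| + #|B|.
Proof. exact: (leq_card_setU A B).1. Qed.

Lemma cardU_disjoint A B : [disjoint A & B] -> #|A :|: B| = #|A| + #|B|.
Proof. by move=> dAB; apply/eqP; rewrite (leq_card_setU A B). Qed.

Lemma exists_subset A r : r <= #|A| -> exists2 B : {set T}, B \subset A & #|B| = r.
Proof.
elim: r => [|r IHr] rA; first by exists set0; rewrite ?sub0set ?cards0.
have [B sBA cB] := IHr (ltnW rA).
have /set0Pn[x] : A :\: B != set0.
  rewrite -card_gt0 cardsD (setIidPr sBA); lia.
rewrite inE => /andP[xB xA]; exists (x |: B); last by rewrite cardsU1 xB cB.
by rewrite subUset sub1set xA.
Qed.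

Lemma exists_notin A : #|A| < #|T| -> exists z, z \notin A.
Proof.
move=> h; have /set0Pn[z] : ~: A != set0.
  by rewrite -card_gt0; have := cardsC A; lia.
by rewrite inE; exists z.
Qed.

Lemma exists_avoiding A r : #|A| + r <= #|T| ->
  exists2 B : {set T}, [disjoint B & A] & #|B| = r.
Proof.
move=> h; have [|B sB cB] := @exists_subset (~: A) r.
  by have := cardsC A; lia.
by exists B => //; rewrite disjoints_subset.
Qed.

Lemma trivIset_sum_cardI (F : {set {set T}}) A :
  trivIset F -> (\sum_(B in F) #|B :&: A|)%N = #|cover F :&: A|.
Proof.
move=> tF; rewrite -sum1_card; under [RHS]eq_bigl do rewrite inE.
rewrite big_mkcondr (big_trivIset _ tF).
apply: eq_bigr => e _; rewrite -sum1_card -big_mkcondr.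
by apply: eq_bigl => x; rewrite inE.
Qed.

Lemma trivIset_meeting (F : {set {set T}}) A :
  trivIset F -> #|[set B in F | ~~ [disjoint B & A]]| <= #|A|.
Proof.
move=> tF; apply: leq_trans (subset_leq_card (subsetIr (cover F) A)).
rewrite -trivIset_sum_cardI // -sum1_card; under eq_bigl do rewrite inE.
rewrite big_mkcondr; apply: leq_sum => B _; case: ifP => //.
by rewrite -setI_eq0 -card_gt0.
Qed.

(** Two unrelated vertices [x], [y] with fewer than [r] common neighbours have neighbourhoods that
    cover everything, and the differences [A] and [B] of these are cliques, since two non-neighbours
    of one vertex are related. A vertex of the small overlap joins [V] if it has [r] neighbours in
    [A]; otherwise [3 * r <= d] leaves it [r] neighbours in [B]. *)
Lemma dominating_partition (R : rel T) r d :
  symmetric R -> (forall x y z, [|| R x y, R x z | R y z]) ->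
  (forall x, d <= #|[set z | R x z]|) -> 3 * r <= d ->
  (forall x y, R x y || (r <= #|[set z | R x z && R z y]|)) \/
  exists V A B : {set T}, [/\ A \subset V, [disjoint B & V], d - r <= #|A|, d - r <= #|B| &
    (forall x a, x \in V -> a \in A -> r <= #|[set z | R x z && R z a]|) /\
    (forall x b, x \notin V -> b \in B -> r <= #|[set z | R x z && R z b]|)].
Proof.
move=> Rsym R3 Rdeg rd.
case: (boolP [forall x, forall y, R x y || (r <= #|[set z | R x z && R z y]|)]).
  by move=> /forallP h; left => x y; have /forallP := h x; apply.
move=> /forallPn[x /forallPn[y]]; rewrite negb_or -ltnNge => /andP[nxy cxy]; right.
have Rxx z : R z z by have := R3 z z z; rewrite !orbb.
pose N u := [set z | R u z].
have NE u v : (u \in N v) = R v u by rewrite inE.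
pose C := N x :&: N y; pose A := N x :\: N y; pose B := N y :\: N x.
have cC : #|C| < r.
  apply: leq_trans cxy; rewrite ltnS subset_leq_card //; apply/subsetP => z.
  by rewrite !inE => /andP[->]; rewrite Rsym.
have cov z : (z \in N x) || (z \in N y).
  by rewrite !NE; have := R3 x y z; rewrite (negPf nxy).
have cN u : #|N u| <= #|N u :&: A| + #|N u :&: B| + #|C|.
  have s : N u \subset (N u :&: A) :|: (N u :&: B) :|: C.
    apply/subsetP => z; have := cov z; rewrite !(in_setU, in_setI, in_setD).
    by case: (z \in N x); case: (z \in N y); case: (z \in N u).
  apply: leq_trans (subset_leq_card s) _.
  have := leq_cardU ((N u :&: A) :|: (N u :&: B)) C.
  have := leq_cardU (N u :&: A) (N u :&: B); lia.
have clA a a' : a \in A -> a' \in A -> R a a'.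
  rewrite !in_setD !NE => /andP[/negPf na _] /andP[/negPf na' _].
  by have := R3 y a a'; rewrite na na'.
have clB a a' : a \in B -> a' \in B -> R a a'.
  rewrite !in_setD !NE => /andP[/negPf na _] /andP[/negPf na' _].
  by have := R3 x a a'; rewrite na na'.
have cA : d - r <= #|A|.
  by have := Rdeg x; rewrite -/(N x); have := cardsID (N y) (N x); rewrite -/A -/C; lia.
have cB : d - r <= #|B|.
  have := Rdeg y; rewrite -/(N y); have := cardsID (N x) (N y).
  by rewrite -/B setIC -/C; lia.
have com (E : {set T}) u a : {in E &, forall b b', R b b'} -> a \in E -> r <= #|N u :&: E| ->
  r <= #|[set z | R u z && R z a]|.
  move=> clE aE; move=> h; apply: leq_trans h _; apply: subset_leq_card.
  apply/subsetP => z; rewrite !inE => /andP[uz zE].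
  by rewrite uz clE.
exists (A :|: [set u in C | r <= #|N u :&: A|]), A, B; split=> //.
- exact: subsetUl.
- rewrite disjointE; apply/forallP => z; rewrite in_setU in_setD in_set in_setI in_setD.
  by case: (z \in N x); case: (z \in N y).
split=> u a.
  rewrite in_setU => /orP[uA|uC] aA; apply: (com A) => //.
  - have -> : N u :&: A = A by apply/setIidPr/subsetP => z zA; rewrite inE clA.
    lia.
  - by move: uC; rewrite inE => /andP[].
rewrite in_setU negb_or => /andP[uA]; rewrite in_set negb_and => uC aB.
apply: (com B) => //.
have := cN u; have := Rdeg u; rewrite -/(N u).
case/orP: uC => uC; last by rewrite -ltnNge in uC; lia.
suff -> : N u :&: B = B by lia.
apply/setIidPr/subsetP => z zB; rewrite inE clB //.
by move: uA uC (cov u); rewrite in_setD in_setI in_setD; case: (u \in N x); case: (u \in N y).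
Qed.

End SetAux.

(* Set-algebraic goals are decided at a point [z]: the disjointness, inclusion
   and membership hypotheses are instantiated there and the atoms [z \in A]
   are case-split. *)
Ltac at_point z :=
  repeat match goal with
  | H : is_true [disjoint _ & _] |- _ => move: (disjoint_at H z); clear H
  | H : is_true (_ \subset _) |- _ => move: (subset_at H z); clear H
  | H : is_true (_ \in _) |- _ => move: H
  | H : is_true (_ \notin _) |- _ => move: H
  | H : is_true (_ != _) |- _ => move: H
  end;
  rewrite ?inE;
  repeat (match goal with |- context [?x == ?y] =>
    is_var x; is_var y;
    case: (eqVneq x y) => [?|?]; [subst x|]; rewrite ?inE ?eqxx //= end;
    try match goal with H : is_true (?x != ?x) |- _ => by rewrite eqxx in H end);
  repeat (match goal with |- context [?z \in ?A] => case: (z \in A) end;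
          rewrite /= ?andbF ?andbT ?orbF ?orbT ?implybT ?implybF //);
  try by [].
Ltac set_dec :=
  let z := fresh "z" in
  lazymatch goal with
  | |- is_true [disjoint _ & _] =>
      rewrite disjointE; apply/forallP => z; at_point z
  | |- is_true (_ \subset _) =>
      apply/subsetP => z; apply/implyP; at_point z
  | |- _ = _ => apply/setP => z; at_point z
  end.

Ltac nlia :=
  repeat match goal with
  | H : ?P |- _ =>
    lazymatch P with
    | is_true (leq _ _) => fail
    | @eq nat _ _ => fail
    | is_true (_ && _) => fail
    | _ => clear H
    end
  end; lia.

(** * Matchings and codegrees *)

Section Matched.
Variables (T : finType) (G : {set {set T}}).
Implicit Types (A B W X Y Z : {set T}).

(** Matchings are handled through the vertex sets they cover; a perfect matching exists exactly when
    the full vertex set is [matched]. *)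
Definition matched X :=
  [exists M : {set {set T}}, [&& M \subset G, trivIset M & cover M == X]].

Lemma matched0 : matched set0.
Proof.
apply/existsP; exists set0; rewrite sub0set /cover big_set0 eqxx andbT /=.
by apply/trivIsetP => A B; rewrite inE.
Qed.

Lemma matched1 e : e \in G -> matched e.
Proof.
move=> eG; apply/existsP; exists [set e].
rewrite sub1set eG cover1 eqxx andbT /=.
by apply/trivIsetP => A B /set1P-> /set1P->; rewrite eqxx.
Qed.

Lemma matchedU X A B :
  X = A :|: B -> [disjoint A & B] -> matched A -> matched B -> matched X.
Proof.
move=> -> dAB /existsP[M /and3P[sM tM /eqP cM]].
move=> /existsP[N /and3P[sN tN /eqP cN]].
move/trivIsetP: tM => tM; move/trivIsetP: tN => tN.
apply/existsP; exists (M :|: N).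
rewrite subUset sM sN /cover bigcup_setU -/(cover M) -/(cover N) cM cN eqxx andbT /=.
have cross e f : e \in M -> f \in N -> [disjoint e & f].
  move=> eM fN; apply: disjointW dAB; rewrite -?cM -?cN; exact: bigcup_sup.
rewrite andbT; apply/trivIsetP => e f /setUP[eM|eN] /setUP[fM|fN] nef.
- exact: tM.
- exact: cross.
- by rewrite disjoint_sym; exact: cross.
- exact: tN.
Qed.

Lemma dvdn_matched k X : (forall e, e \in G -> #|e| = k) -> matched X -> k %| #|X|.
Proof.
move=> Gk /existsP[M /and3P[sM tM /eqP <-]]; rewrite -(eqP tM).
by apply: dvdn_sum => e /(subsetP sM) /Gk ->.
Qed.

End Matched.

Section Codegree.
Variables (T : finType) (G : {set {set T}}) (k D : nat).
Hypothesis k3 : 3 <= k.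
Hypothesis Gk : forall e, e \in G -> #|e| = k.
Implicit Types (A B W X Y Z P : {set T}).

Definition nbr W : {set T} := [set v | v |: W \in G].

Lemma nbr_notin v W : #|W| = k.-1 -> v \in nbr W -> v \notin W.
Proof.
move=> cW; rewrite inE => /Gk; rewrite cardsU1 cW.
by case: (v \in W) => //=; nlia.
Qed.

Hypothesis GD : forall W, #|W| = k.-1 -> D <= #|nbr W|.

Lemma nbr_avoiding W Z : #|W| = k.-1 -> #|Z| < D -> exists2 v, v \in nbr W & v \notin Z.
Proof.
move=> cW ZD; have /set0Pn[v] : nbr W :\: Z != set0.
  rewrite -card_gt0 cardsD; have := GD cW.
  by have := subset_leq_card (subsetIr (nbr W) Z); nlia.
by rewrite inE => /andP[vZ vW]; exists v.
Qed.

(** The edge is reread as [x] completing [w |: P]. As this set does not involve [x], a common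
    neighbour [w] of [x |: P] and [y |: P] yields one set completed by both [x] and [y]. *)
Lemma nbrU1 x P w : #|P| = k.-2 -> w |: P \subset ~: [set x] ->
  w \in nbr (x |: P) -> #|w |: P| = k.-1 /\ (x |: (w |: P)) \in G.
Proof.
rewrite inE => cP; rewrite subUset !sub1set !inE => /andP[wx].
rewrite subsetC sub1set inE => xP wG; split; last by rewrite setUCA.
have := Gk wG; rewrite setUCA cardsU1 !inE negb_or eq_sym wx xP /=; nlia.
Qed.

(* Avoiding every set of at most [m] vertices stands in for the usual
   requirement that there be many connecting sets. *)
Definition colinked m x y := [forall Z : {set T}, (#|Z| <= m) ==>
  [exists W : {set T}, [&& #|W| == k.-1, [disjoint W & Z], x |: W \in G & y |: W \in G]]].

Lemma colinkedP m x y : reflect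
  (forall Z, #|Z| <= m -> exists W, [/\ #|W| = k.-1, [disjoint W & Z], x |: W \in G & y |: W \in G])
  (colinked m x y).
Proof.
apply: (iffP forallP) => [h Z cZ|h Z].
  have := h Z; rewrite cZ => /existsP[W /and4P[/eqP ? ? ? ?]]; by exists W.
by apply/implyP => /h[W [? ? ? ?]]; apply/existsP; exists W; apply/and4P; split=> //; apply/eqP.
Qed.

Lemma colinkedC m x y : colinked m x y = colinked m y x.
Proof.
by apply: eq_forallb => Z; congr (_ ==> _); apply: eq_existsb => W; congr [&& _, _ & _]; rewrite andbC.
Qed.

(** If all three pairs fail, choose [P] of [k - 2] vertices off the three witnessing sets. A [w]
    outside these sets that completes both [x |: P] and [y |: P] would link [x] and [y] through
    [w |: P]. So three sets of at least [D - 3 * m] vertices are pairwise disjoint, too many for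
    [T]. *)
Lemma colinked_triple m x y z : #|T| + 9 * m < 3 * D -> 3 * m + k + 3 <= #|T| ->
  [|| colinked m x y, colinked m x z | colinked m y z].
Proof.
move=> mD mT; apply/negPn/negP; rewrite !negb_or => /and3P[].
have neg u v : ~~ colinked m u v -> exists2 Z : {set T}, #|Z| <= m &
    forall W, #|W| = k.-1 -> [disjoint W & Z] -> u |: W \in G -> v |: W \in G -> False.
  move=> /forallPn[Z]; rewrite negb_imply => /andP[cZ /existsPn h]; exists Z => // W cW dW uW vW.
  by have := h W; rewrite cW eqxx dW uW vW.
move=> /neg[Z1 c1 h1] /neg[Z2 c2 h2] /neg[Z3 c3 h3].
have [Z [s1 s2 s3 cZ]] : exists Z, [/\ Z1 \subset Z, Z2 \subset Z, Z3 \subset Z & #|Z| <= 3 * m].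
  exists (Z1 :|: Z2 :|: Z3); split; [by set_dec.. |].
  have := leq_cardU (Z1 :|: Z2) Z3; have := leq_cardU Z1 Z2; nlia.
have [P dP cP] : exists2 P : {set T}, [disjoint P & [set x; y; z] :|: Z] & #|P| = k.-2.
  apply: exists_avoiding.
  have := leq_cardU [set x; y; z] Z; have := leq_cardU [set x; y] [set z].
  have := leq_cardU [set x] [set y]; rewrite !cards1; nlia.
have cN u : u \notin P -> D <= #|nbr (u |: P)|.
  by move=> uP; apply: GD; rewrite cardsU1 uP cP; nlia.
have no u v : u \notin P -> v \notin P ->
  (forall W, #|W| = k.-1 -> [disjoint W & Z] -> u |: W \in G -> v |: W \in G -> False) ->
  [disjoint nbr (u |: P) :\: Z & nbr (v |: P) :\: Z].
  move=> uP vP h; rewrite disjointE; apply/forallP => w; apply/negP.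
  rewrite !in_setD => /andP[/andP[wZ wu] /andP[_ wv]].
  have nw t : t \notin P -> w \in nbr (t |: P) -> w != t.
    move=> tP /nbr_notin; rewrite cardsU1 tP cP !inE negb_or => h'.
    by have /andP[] : (w != t) && (w \notin P) by apply: h'; clear -k3; nlia.
  have sub t : t \notin P -> w \in nbr (t |: P) -> w |: P \subset ~: [set t].
    move=> tP /(nw _ tP) wt; rewrite subUset sub1set !inE wt.
    by rewrite subsetC sub1set inE.
  have [cW uW] := nbrU1 cP (sub _ uP wu) wu.
  have [_ vW] := nbrU1 cP (sub _ vP wv) wv.
  by apply: h cW _ uW vW; set_dec.
have xP : x \notin P by apply/negP => xP; have := disjoint_at dP x; rewrite xP !inE eqxx.
have yP : y \notin P by apply/negP => yP; have := disjoint_at dP y; rewrite yP !inE eqxx orbT.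
have zP : z \notin P by apply/negP => zP; have := disjoint_at dP z; rewrite zP !inE eqxx !orbT.
have d12 := no _ _ xP yP (fun W c d => h1 W c (disjointWr s1 d)).
have d13 := no _ _ xP zP (fun W c d => h2 W c (disjointWr s2 d)).
have d23 := no _ _ yP zP (fun W c d => h3 W c (disjointWr s3 d)).
have cD u : u \notin P -> D - 3 * m <= #|nbr (u |: P) :\: Z|.
  move=> /cN cu; rewrite cardsD; have := subset_leq_card (subsetIr (nbr (u |: P)) Z); clear -cu cZ; nlia.
have := max_card (mem ((nbr (x |: P) :\: Z) :|: (nbr (y |: P) :\: Z) :|: (nbr (z |: P) :\: Z))).
rewrite cardU_disjoint; last by clear -d13 d23; set_dec.
rewrite (cardU_disjoint d12); have := cD _ xP; have := cD _ yP; have := cD _ zP; nlia.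
Qed.

End Codegree.

(** * Linked vertices *)

Section Linked.
Variables (T : finType) (G : {set {set T}}).
Implicit Types (W X Y Z : {set T}) (x y : T).

(** In contrast with [colinked], the size of [W] is only bounded, so that links can be composed. *)
Definition linked m s x y := forall Z, #|Z| <= m ->
  exists W, [/\ #|W| <= s, [disjoint W & Z], matched G (x |: W) & matched G (y |: W)].

Lemma linkedW m s m' s' x y : m' <= m -> s <= s' -> linked m s x y -> linked m' s' x y.
Proof.
by move=> mm ss h Z cZ; have [|W [? ? ? ?]] := h Z; [exact: leq_trans mm|exists W; split=> //; exact: leq_trans ss].
Qed.

(** With [W1] for [x], [z] and [W2] for [z], [y], the set [W1 :|: (z |: W2)] links [x] and [y]: [z]
    is matched with [W2] when [x] takes [W1], and with [W1] when [y] takes [W2]. The size of [C]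
    provides a [z] off [Z], [x] and [y]. *)
Lemma linked_trans m s m' (C : {set T}) x y :
  (forall z, z \in C -> linked m s x z /\ linked m s z y) ->
  m' + 3 <= #|C| -> m' + s + 3 <= m -> linked m' (2 * s + 1) x y.
Proof.
move=> CP cC mm Z cZ.
have [z zC] : exists2 z, z \in C & z \notin Z :|: [set x; y].
  have /set0Pn[z] : C :\: (Z :|: [set x; y]) != set0.
    rewrite -card_gt0 cardsD; have := subset_leq_card (subsetIr C (Z :|: [set x; y])).
    have := leq_cardU Z [set x; y]; rewrite cards2; nlia.
  by rewrite inE => /andP[zZ zC]; exists z.
rewrite !inE !negb_or => /and3P[zZ zx zy].
have [h1 h2] := CP z zC; pose V := Z :|: [set x; y; z].
have cV : #|V| <= #|Z| + 3.
  have := leq_cardU Z [set x; y; z]; have := leq_cardU [set x; y] [set z].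
  by rewrite -/V cards1 cards2; nlia.
have [|W1 [c1 d1 x1 z1]] := h1 V; first by nlia.
have [|W2 [c2 d2 z2 y2]] := h2 (V :|: W1).
  by have := leq_cardU V W1; nlia.
rewrite /V in d1 d2; exists (W1 :|: (z |: W2)); split.
- have := leq_cardU W1 (z |: W2); have := leq_cardU [set z] W2; rewrite cards1; nlia.
- by clear -d1 d2 zZ; set_dec.
- apply: matchedU x1 z2; first by set_dec.
  by clear -d1 d2 zx zy; set_dec.
- apply: matchedU z1 y2; first by set_dec.
  by clear -d1 d2 zx zy; set_dec.
Qed.

End Linked.

Section Colinked.
Variables (T : finType) (G : {set {set T}}) (k D : nat).
Implicit Types (A B W X Y Z P L : {set T}).
Hypothesis k3 : 3 <= k.
Hypothesis Gk : forall e, e \in G -> #|e| = k.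
Hypothesis GD : forall W, #|W| = k.-1 -> D <= #|nbr G W|.

Lemma link_avoiding x Z : #|Z| < D -> #|Z| + k <= #|T| ->
  exists W, [/\ #|W| = k.-1, [disjoint W & Z] & x |: W \in G].
Proof.
move=> ZD ZT; have [|P dP cP] := @exists_avoiding _ (x |: Z) k.-2.
  have := leq_cardU [set x] Z; rewrite cards1; lia.
have xP : x \notin P by clear -dP; apply/negP => xP; have := disjoint_at dP x; rewrite xP !inE eqxx.
have cxP : #|x |: P| = k.-1 by rewrite cardsU1 xP cP; nlia.
have [w wN wZ] := nbr_avoiding k3 GD cxP ZD.
have := nbr_notin k3 Gk cxP wN; rewrite inE negb_or inE => /andP[wx wP].
have [|cW xW] := nbrU1 k3 Gk cP _ wN; first by clear -wx xP; set_dec.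
by exists (w |: P); split=> //; clear -dP wZ; set_dec.
Qed.

Lemma disjoint_links x r : r * k.-1 < D -> r * k.-1 + k <= #|T| ->
  exists F : {set {set T}}, [/\ trivIset F, #|F| = r,
    #|cover F| = (r * k.-1)%N & forall W, W \in F -> #|W| = k.-1 /\ x |: W \in G].
Proof.
elim: r => [|r IHr] rD rT.
  exists set0; rewrite cards0 /cover big_set0 cards0; split=> // [|W].
    by apply/trivIsetP => A B; rewrite inE.
  by rewrite inE.
have [||F [tF cF cU FP]] := IHr; try by clear -rD rT; lia.
have [||W [cW dW xW]] := @link_avoiding x (cover F); rewrite ?cU; try by clear -rD rT; lia.
have WF : W \notin F.
  apply/negP => WF; have : W \subset cover F by apply: bigcup_sup.
  move=> /(disjointWr)/(_ dW); rewrite -setI_eq0 setIid => /eqP W0.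
  by move: cW; rewrite W0 cards0; clear -k3; lia.
exists (W |: F); split.
- apply/trivIsetP => A B /setU1P[->|AF] /setU1P[->|BF]; rewrite ?eqxx // => nAB.
  + by apply: disjointWr dW; apply: bigcup_sup.
  + by rewrite disjoint_sym; apply: disjointWr dW; apply: bigcup_sup.
  + by move/trivIsetP: tF; apply.
- by rewrite cardsU1 WF cF.
- by rewrite /cover big_setU1 //= cardU_disjoint // cU cW; lia.
- by move=> A /setU1P[->|/FP].
Qed.

(** Count the pairs of a set [W] among [6 * m] disjoint links of [x] and a vertex [y] completing it.
    There are at least [6 * m * D]. A [y] not colinked to [x] is in at most [m] of them, since all
    its sets [W] meet one set of at most [m] vertices; any other [y] is in at most [6 * m]. *)
Lemma colinked_degree m x : 0 < m -> #|T| <= 3 * D -> 6 * m * k.-1 < D ->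
  6 * m * k.-1 + k <= #|T| -> #|T| <= 6 * #|[set y | colinked G k m x y]|.
Proof.
move=> m0 TD mD mT; have [F [tF cF _ FP]] := disjoint_links x mD mT.
set d := #|[set _ | _]|.
pose a y := #|[set W in F | y \in nbr G W]|.
have sa : (\sum_(W in F) #|nbr G W| = \sum_y a y)%N.
  rewrite -(eq_bigr _ (fun W _ => sum1_card (mem (nbr G W)))) (exchange_big_dep xpredT) //=.
  by apply: eq_bigr => y _; rewrite /a -sum1_card; apply: eq_bigl => W; rewrite [in RHS]inE.
have ga : 6 * m * D <= \sum_y a y.
  by rewrite -sa -cF -sum_nat_const; apply: leq_sum => W /FP[/GD].
have ua y : a y <= m + (if colinked G k m x y then 6 * m else 0).
  case: ifP => [_|/negbT/forallPn[Z]].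
    apply: leq_trans (leq_addl _ _); rewrite -cF; apply: subset_leq_card.
    by apply/subsetP => W; rewrite inE => /andP[].
  rewrite negb_imply addn0 => /andP[cZ /existsPn nZ].
  apply: leq_trans cZ; apply: leq_trans (trivIset_meeting Z tF).
  apply: subset_leq_card; apply/subsetP => W; rewrite !inE => /andP[WF yW].
  rewrite WF; have [cW xW] := FP _ WF; apply: contra (nZ W) => dW.
  by rewrite cW eqxx dW xW.
have : \sum_y a y <= m * #|T| + 6 * m * d.
  have -> : m * #|T| + 6 * m * d = (\sum_y (m + (if colinked G k m x y then 6 * m else 0)))%N.
    rewrite big_split /= sum_nat_const mulnC -big_mkcond sum_nat_const.
    by rewrite [#|_| * (6 * m)]mulnC /d cardsE.
  by apply: leq_sum => y _; apply: ua.
move=> h; have : m * (6 * D) <= m * (#|T| + 6 * d) by clear -ga h; lia.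
by rewrite leq_pmul2l //; clear -TD; lia.
Qed.

Lemma colinked_linked m x y : colinked G k m x y -> linked G m k.-1 x y.
Proof.
move=> /colinkedP h Z /h[W [cW dW xW yW]]; exists W.
by split; rewrite ?cW //; apply: matched1.
Qed.

End Colinked.

(** * Absorbing sets *)

Section Absorbing.
Variables (T : finType) (G : {set {set T}}) (k : nat).
Hypothesis Gk : forall e, e \in G -> #|e| = k.
Implicit Types (A B W X Y Z P L V : {set T}) (i : nat) (ts us : seq nat).

Definition robust V m (i : nat) := [forall Z : {set T}, (#|Z| <= m) ==>
  [exists e : {set T}, [&& e \in G, [disjoint e & Z] & #|e :&: V| == i]]].

Lemma robustP V m i : reflect
  (forall Z, #|Z| <= m -> exists e, [/\ e \in G, [disjoint e & Z] & #|e :&: V| = i])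
  (robust V m i).
Proof.
apply: (iffP forallP) => [h Z cZ|h Z].
  by have := h Z; rewrite cZ => /existsP[e /and3P[? ? /eqP ?]]; exists e.
by apply/implyP => /h[e [? ? /eqP ?]]; apply/existsP; exists e; apply/and3P.
Qed.

(** [Y] is an absorber of [L]. It is certain to be disjoint from [L] only if [Z] contains [L], which
    is why [absorb_all] asks for [L \subset Z]. *)
Definition absorbable m s L := [forall Z : {set T}, (#|Z| <= m) ==>
  [exists Y : {set T}, [&& #|Y| <= s, [disjoint Y & Z], matched G Y & matched G (L :|: Y)]]].

Lemma absorbableP m s L : reflect
  (forall Z, #|Z| <= m ->
    exists Y, [/\ #|Y| <= s, [disjoint Y & Z], matched G Y & matched G (L :|: Y)])
  (absorbable m s L).
Proof.
apply: (iffP forallP) => [h Z cZ|h Z].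
  by have := h Z; rewrite cZ => /existsP[Y /and4P[? ? ? ?]]; exists Y.
by apply/implyP => /h[Y [? ? ? ?]]; apply/existsP; exists Y; apply/and4P.
Qed.

Lemma linkedC m s x y : linked G m s x y -> linked G m s y x.
Proof. by move=> h Z /h[W [? ? ? ?]]; exists W. Qed.

Section Linked.
Variables (V : {set T}) (m s : nat).
Hypothesis Vlinked : forall x y, (x \in V) = (y \in V) -> linked G m s x y.

Lemma linked_sets r A B Z : #|A| = r -> #|B| = r -> #|A :&: V| = #|B :&: V| ->
  #|Z| + 2 * r + r * s <= m ->
  exists W, [/\ #|W| <= r * s, [disjoint W & Z :|: A :|: B],
                matched G (A :|: W) & matched G (B :|: W)].
Proof.
elim: r A B Z => [|r IHr] A B Z cA cB cV cZ.
  exists set0; rewrite (cards0_eq cA) (cards0_eq cB) !setU0 cards0.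
  by split; rewrite ?matched0 // -setI_eq0 set0I.
have [x xA] : exists x, x \in A by apply/set0Pn; rewrite -card_gt0 cA.
have [y yB xy] : exists2 y, y \in B & (x \in V) = (y \in V).
  case xV : (x \in V).
    have /set0Pn[y] : B :&: V != set0.
      by rewrite -card_gt0 -cV; apply/card_gt0P; exists x; rewrite inE xA.
    by rewrite inE => /andP[yB yV]; exists y; rewrite ?yV.
  have /set0Pn[y] : B :\: V != set0.
    rewrite -card_gt0; have := cardsID V A; have := cardsID V B.
    have : 0 < #|A :\: V| by apply/card_gt0P; exists x; rewrite inE xV.
    by clear -cA cB cV; nlia.
  by rewrite inE => /andP[/negPf yV yB]; exists y; rewrite ?yV.
have cA' : #|A :\ x| = r by move: cA; rewrite (cardsD1 x) xA => -[].
have cB' : #|B :\ y| = r by move: cB; rewrite (cardsD1 y) yB => -[].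
have cV' : #|(A :\ x) :&: V| = #|(B :\ y) :&: V|.
  rewrite ![_ :\ _]setDE -!setIA ![~: _ :&: V]setIC !setIA -!setDE.
  have := cardsD1 x (A :&: V); have := cardsD1 y (B :&: V).
  by rewrite !inE xA yB cV xy; clear; nlia.
have cZ2 : #|Z :|: [set x; y]| <= #|Z| + 2.
  by have := leq_cardU Z [set x; y]; rewrite cards2; case: (x != y); clear; nlia.
have [|W1 [c1 d1 A1 B1]] := IHr _ _ (Z :|: [set x; y]) cA' cB' cV'.
  by clear -cZ cZ2; nlia.
have [|W2 [c2 d2 x2 y2]] := Vlinked xy (Z := Z :|: A :|: B :|: W1).
  have := leq_cardU (Z :|: A :|: B) W1; have := leq_cardU (Z :|: A) B.
  by have := leq_cardU Z A; clear -cZ c1 cA cB; nlia.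
exists (W2 :|: W1); split.
- by have := leq_cardU W2 W1; clear -c1 c2; nlia.
- clear -d1 d2; set_dec.
- by apply: matchedU x2 A1; clear -d1 d2 xA; set_dec.
- by apply: matchedU y2 B1; clear -d1 d2 yB; set_dec.
Qed.

Lemma linked_transferral i m' s' : robust V m i -> robust V m i.+1 ->
  m' + 2 * k + 2 + 2 * k.+1 + k.+1 * s <= m -> k.+1 * s + 2 * k <= s' ->
  forall x y, linked G m' s' x y.
Proof.
move=> /robustP ri /robustP ri1 mm ss x y.
wlog : x y / (y \in V) ==> (x \in V).
  move=> h; case xV : (x \in V); first by apply: h; rewrite xV implybT.
  by apply: linkedC; apply: h; rewrite xV.
case xy : ((x \in V) == (y \in V)).
  move=> _; apply: linkedW (Vlinked (eqP xy)); have := leq_pmull s (ltn0Sn k); clear -mm ss; nlia.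
case xV : (x \in V) xy; case yV : (y \in V) => // _ _ Z cZ.
have c2 : #|Z :|: [set x; y]| <= m' + 2.
  by have := leq_cardU Z [set x; y]; rewrite cards2; case: (x != y); clear -cZ; nlia.
have [|f [fG df fi]] := ri (Z :|: [set x; y]); first by clear -c2 mm; nlia.
have c3 : #|Z :|: [set x; y] :|: f| <= m' + 2 + k.
  by have := leq_cardU (Z :|: [set x; y]) f; rewrite (Gk fG); clear -c2; nlia.
have [|e [eG de ei]] := ri1 (Z :|: [set x; y] :|: f); first by clear -c3 mm; nlia.
have c4 : #|Z :|: [set x; y] :|: f :|: e| <= m' + 2 + 2 * k.
  by have := leq_cardU (Z :|: [set x; y] :|: f) e; rewrite (Gk eG); clear -c3; nlia.
have xf : x \notin f by apply/negP => xf; have := disjoint_at df x; rewrite xf !inE eqxx !orbT.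
have ye : y \notin e by apply/negP => ye; have := disjoint_at de y; rewrite ye !inE eqxx !orbT.
have [||||W [cW dW fW eW]] := @linked_sets k.+1 (x |: f) (y |: e) (Z :|: [set x; y] :|: f :|: e).
- by rewrite cardsU1 xf (Gk fG).
- by rewrite cardsU1 ye (Gk eG).
- have -> : (x |: f) :&: V = x |: (f :&: V) by rewrite setIUl (setIidPl _) // sub1set.
  have -> : (y |: e) :&: V = e :&: V.
    by rewrite setIUl (_ : [set y] :&: V = set0) ?set0U //; apply/setP=> z; rewrite !inE; case: eqP => // ->; rewrite yV.
  by rewrite cardsU1 inE negb_and xf fi ei.
- by clear -c4 mm; nlia.
have xy : x != y by apply/eqP => xy; rewrite xy yV in xV.
exists (W :|: e :|: f); split.
- have := leq_cardU (W :|: e) f; have := leq_cardU W e; rewrite (Gk eG) (Gk fG).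
  by clear -cW ss; nlia.
- by clear -dW de df; set_dec.
- apply: (@matchedU _ _ _ (x |: f :|: W) e) fW (matched1 eG); first by clear; set_dec.
  by clear -dW de df; set_dec.
- apply: (@matchedU _ _ _ (y |: e :|: W) f) eW (matched1 fG); first by clear; set_dec.
  by clear -dW de df; set_dec.
Qed.

Lemma fresh_matched ts Z : all (robust V m) ts -> #|Z| + k * size ts <= m ->
  exists E : {set T}, [/\ [disjoint E & Z], matched G E, #|E| = (k * size ts)%N & #|E :&: V| = sumn ts].
Proof.
elim: ts Z => [|i ts IH] Z /=.
  exists set0; rewrite set0I cards0 muln0; split=> //; last exact: matched0.
  by rewrite -setI_eq0 set0I.
move=> /andP[/robustP ri rts] cZ.
have [|e [eG de ei]] := ri Z; first by clear -cZ; nlia.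
have [|E [dE mE cE vE]] := IH (Z :|: e) rts.
  by have := leq_cardU Z e; rewrite (Gk eG); clear -cZ; nlia.
have dEe : [disjoint E & e] by clear -dE; set_dec.
exists (E :|: e); split.
- by clear -dE de; set_dec.
- exact: matchedU dEe mE (matched1 eG).
- by rewrite cardU_disjoint // cE (Gk eG); clear; nlia.
- by rewrite setIUl cardU_disjoint ?vE ?ei 1?addnC //; clear -dEe; set_dec.
Qed.

(** Disjoint edges of types [us] form [F], those of types [ts] form [E]. The two counts make
    [L :|: F] and [E] linkable by some [W]. The absorber [W :|: F :|: E] splits into [E :|: W] and
    [F] without [L], and into [L :|: F :|: W] and [E] with it. *)
Lemma absorbable_types ts us L m' s' :
  all (robust V m) ts -> all (robust V m) us ->
  #|L| + k * size us = (k * size ts)%N -> #|L :&: V| + sumn us = sumn ts ->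
  m' + #|L| + k * size us + 3 * (k * size ts) + k * size ts * s <= m ->
  k * size us + k * size ts + k * size ts * s <= s' ->
  absorbable m' s' L.
Proof.
move=> rts rus cL vL mm ss; apply/absorbableP => Z cZ.
have cZL : #|Z :|: L| <= m' + #|L| by have := leq_cardU Z L; clear -cZ; nlia.
have [|F [dF mF cF vF]] := @fresh_matched us (Z :|: L) rus; first by clear -cZL mm; nlia.
have cZF : #|Z :|: L :|: F| <= m' + #|L| + k * size us.
  by have := leq_cardU (Z :|: L) F; rewrite cF; clear -cZL; nlia.
have [|E [dE mE cE vE]] := @fresh_matched ts (Z :|: L :|: F) rts; first by clear -cZF mm; nlia.
have dLF : [disjoint L & F] by clear -dF; set_dec.
have [||||W [cW dW LW EW]] := @linked_sets (k * size ts) (L :|: F) E (Z :|: L :|: F :|: E).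
- by rewrite cardU_disjoint // cF.
- by [].
- by rewrite setIUl cardU_disjoint ?vL ?vF ?vE //; clear -dLF; set_dec.
- have := leq_cardU (Z :|: L :|: F) E; rewrite cE; clear -cZF mm; nlia.
exists (W :|: F :|: E); split.
- have := leq_cardU (W :|: F) E; have := leq_cardU W F; rewrite cE cF.
  by clear -cW ss; nlia.
- by clear -dW dE dF; set_dec.
- apply: (matchedU _ _ EW mF); first by clear; set_dec.
  by clear -dE dW; set_dec.
- apply: (matchedU _ _ LW mE); first by clear; set_dec.
  by clear -dE dW; set_dec.
Qed.

(** Replacing an edge of type [a] by one of type [a.+2] shifts the count in [V] by two, so only the
    parity of the leftover matters. *)
Lemma absorbable_parity (a : bool) r L m' s' :
  robust V m a -> robust V m a.+2 -> #|L| = (k * r)%N ->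
  odd #|L :&: V| = a && odd r ->
  m' + k * r + k * (k.+1 * r) + 3 * (k * (k.+2 * r)) + k * (k.+2 * r) * s <= m ->
  k * (k.+1 * r) + k * (k.+2 * r) + k * (k.+2 * r) * s <= s' ->
  absorbable m' s' L.
Proof.
move=> ra ra2 cL oL mm ss.
have lL : #|L :&: V| <= k * r by rewrite -cL subset_leq_card // subsetIl.
(* [N] edges of type [a.+2] in [E] balance the count in [V]. The [r] edges of type [a.+2] put into
   [F] contribute [2 * r], which keeps the subtraction from truncating. *)
pose N := (#|L :&: V| + 2 * r - a * r)./2.
have N2 : (2 * N + a * r = #|L :&: V| + 2 * r)%N.
  have : ~~ odd (#|L :&: V| + 2 * r - a * r).
    rewrite oddB; last by clear; case: (a); nlia.
    by rewrite oddD oL !oddM /=; case: (a); case: (odd r).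
  move/even_halfK; rewrite -/N -mul2n => ->; rewrite subnK //; by clear; case: (a); nlia.
have NL : N <= k.+2 * r by clear -N2 lL; nlia.
apply: (@absorbable_types (nseq N a.+2 ++ nseq (k.+2 * r - N) (a : nat))
  (nseq r a.+2 ++ nseq (k * r) (a : nat))).
- by rewrite all_cat !all_nseq ra ra2 !orbT.
- by rewrite all_cat !all_nseq ra ra2 !orbT.
- rewrite !size_cat !size_nseq subnKC // cL; clear; nlia.
- rewrite !sumn_cat !sumn_nseq; clear -N2 NL; case: (a) N2; nlia.
- rewrite !size_cat !size_nseq subnKC // cL (_ : r + k * r = k.+1 * r)%N //; clear; nlia.
- by rewrite !size_cat !size_nseq subnKC // (_ : r + k * r = k.+1 * r)%N //; clear; nlia.
Qed.

End Linked.
End Absorbing.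

(** * Almost perfect matchings *)

(** A subset of [r.+1] elements is a subset of [r] elements with one of the [#|B|] points added, so
    each step multiplies the bound by [#|B|.+1]. *)
Lemma few_subsets (T : finType) (B : {set T}) r :
  #|[set L : {set T} | (L \subset B) && (#|L| <= r)]| <= #|B|.+1 ^ r.
Proof.
elim: r => [|r IHr].
  rewrite expn0 -(cards1 (set0 : {set T})); apply: subset_leq_card.
  by apply/subsetP => L; rewrite !inE leqn0 cards_eq0 => /andP[].
set S := [set L | _] in IHr; set S' := [set L | _].
have sS : S' \subset S :|: [set x |: L | x in B, L in S].
  apply/subsetP => L; rewrite !inE => /andP[sL cL]; rewrite sL /=.
  case: leqP => //= rL; have /set0Pn[x xL] : L != set0 by rewrite -card_gt0; lia.
  apply/imset2P; exists x (L :\ x); rewrite ?setD1K ?(subsetP sL) //.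
  rewrite inE (subset_trans (subsetDl _ _) sL) /=.
  by move: cL; rewrite (cardsD1 x) xL.
apply: leq_trans (subset_leq_card sS) _; apply: leq_trans (leq_cardU _ _) _.
have : #|[set x |: L | x in B, L in S]| <= #|B| * #|S|.
  rewrite curry_imset2X; apply: leq_trans (leq_imset_card _ _) _.
  by rewrite cardsX.
by rewrite expnS; clear -IHr; nia.
Qed.

Section AlmostPerfect.
Variables (T : finType) (G : {set {set T}}) (k D : nat).
Implicit Types (A B W X Y Z P L S : {set T}).
Hypothesis k3 : 3 <= k.
Hypothesis Gk : forall e, e \in G -> #|e| = k.
Hypothesis GD : forall W, #|W| = k.-1 -> D <= #|nbr G W|.

(** If two of the sets are nonempty, all three have at most one element and [3 <= #|e|] suffices;
    otherwise only one set counts. They will be the vertices of a matching edge that complete three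
    uncovered sets. *)
Lemma card_three_stars (e A B C : {set T}) : 3 <= #|e| -> A \subset e -> B \subset e -> C \subset e ->
  {in A & B, forall x y, x = y} -> {in A & C, forall x y, x = y} -> {in B & C, forall x y, x = y} ->
  #|A| + #|B| + #|C| <= #|e|.
Proof.
move=> e3 sA sB sC AB AC BC.
have one (E F : {set T}) : {in E & F, forall x y : T, x = y} -> #|E| <= 1 \/ #|F| = 0.
  move=> EF; have [->|/set0Pn[y yF]] := eqVneq F set0; [by right; rewrite cards0 | left].
  rewrite -(cards1 y); apply: subset_leq_card; apply/subsetP => x xE.
  by rewrite inE (EF x y).
have sym (E F : {set T}) : {in E & F, forall x y : T, x = y} -> {in F & E, forall x y, x = y}.
  by move=> EF x y xF yE; rewrite (EF y x).
have := subset_leq_card sA; have := subset_leq_card sB; have := subset_leq_card sC.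
have := one _ _ AB; have := one _ _ AC; have := one _ _ BC.
have := one _ _ (sym _ _ AB); have := one _ _ (sym _ _ AC); have := one _ _ (sym _ _ BC).
by clear -e3; nlia.
Qed.

(* In a maximum matching, no edge [e] has two distinct vertices completing two
   of three disjoint uncovered (k-1)-sets: they would replace [e] by two edges. *)
Lemma almost_perfect Z : #|T| + 3 * #|Z| < 3 * D ->
  exists X, [/\ matched G X, X \subset ~: Z & #|~: (Z :|: X)| < 3 * k.-1].
Proof.
move=> TD.
have P0 : matched G set0 && (set0 \subset ~: Z) by rewrite matched0 sub0set.
case: (@arg_maxnP _ set0 (fun X : {set T} => matched G X && (X \subset ~: Z)) (fun X => #|X|) P0).
move=> X /andP[mX sX] maxX; exists X; split=> //; rewrite ltnNge; apply/negP => cU.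
set U := ~: (Z :|: X) in cU.
have UZ : [disjoint U & Z] by rewrite /U; clear; set_dec.
have UX : [disjoint U & X] by rewrite /U; clear; set_dec.
have inU v : v \notin Z -> v \notin X -> v \in U by move=> vZ vX; rewrite !inE negb_or vZ.
clearbody U.
have XZ : [disjoint X & Z] by rewrite disjoints_subset.
have [S1 s1 c1] := @exists_subset _ U k.-1 (leq_trans (leq_pmull _ (isT : 0 < 3)) cU).
have [|S2 s2 c2] := @exists_subset _ (U :\: S1) k.-1.
  by rewrite cardsD (setIidPr s1); clear -c1 cU; nlia.
have [|S3 s3 c3] := @exists_subset _ (U :\: (S1 :|: S2)) k.-1.
  have s12 : S1 :|: S2 \subset U by clear -s1 s2; set_dec.
  by rewrite cardsD (setIidPr s12); have := leq_cardU S1 S2; clear -c1 c2 cU; nlia.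
(* A completing vertex outside [Z] and [X] would give a further edge, contradicting maximality. *)
have inX S v : S \subset U -> #|S| = k.-1 -> v \in nbr G S -> v \notin Z -> v \in X.
  move=> sS cS vS vZ; apply/negPn/negP => vX; have vU := inU v vZ vX.
  have vnS := nbr_notin k3 Gk cS vS; rewrite inE in vS.
  have dX : [disjoint X & v |: S] by clear -sS vX UX; set_dec.
  have := maxX (X :|: (v |: S)); rewrite cardU_disjoint // (Gk vS).
  rewrite (matchedU (erefl _) dX mX (matched1 vS)).
  have -> : X :|: (v |: S) \subset ~: Z by clear -sX sS UZ vZ; set_dec.
  by move=> /(_ isT) /=; clear -k3; nlia.
have cN S : S \subset U -> #|S| = k.-1 -> D - #|Z| <= #|X :&: nbr G S|.
  move=> sS cS; have := GD cS; rewrite -(cardsID Z).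
  have : #|nbr G S :\: Z| <= #|X :&: nbr G S|.
    apply: subset_leq_card; apply/subsetP => v; rewrite in_setD in_setI => /andP[vZ vS].
    by rewrite vS (inX S).
  by have := subset_leq_card (subsetIr (nbr G S) Z); clear; nlia.
have sU2 : S2 \subset U by clear -s2; set_dec.
have sU3 : S3 \subset U by clear -s3; set_dec.
move: (mX) => /existsP[M /and3P[sM tM /eqP cM]].
have clash e S S' : e \in M -> S \subset U -> S' \subset U -> [disjoint S & S'] ->
  #|S| = k.-1 -> #|S'| = k.-1 -> {in e :&: nbr G S & e :&: nbr G S', forall x y, x = y}.
  move=> eM sS sS' dS cS cS' x y /setIP[xe xS] /setIP[ye yS']; apply/eqP/negPn/negP => xy.
  rewrite inE in xS; rewrite inE in yS'.
  have eX : e \subset X by rewrite -cM; apply: bigcup_sup.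
  have mXe : matched G (X :\: e).
    apply/existsP; exists (M :\ e); rewrite (subset_trans (subsetDl _ _) sM) /=.
    apply/andP; split.
      by apply/trivIsetP => A B /setD1P[_ AM] /setD1P[_ BM]; move/trivIsetP: tM; apply.
    rewrite -cM; apply/eqP/setP => z; rewrite in_setD; apply/bigcupP/andP.
      move=> [A /setD1P[Ae AM] zA]; split; last by apply/bigcupP; exists A.
      by have /trivIsetP/(_ A e AM eM Ae) dA := tM; rewrite (disjointFr dA).
    move=> [ze /bigcupP[A AM zA]]; exists A => //; rewrite !inE AM andbT.
    by apply/eqP => Ae; rewrite -Ae zA in ze.
  have d2 : [disjoint x |: S & y |: S'] by clear -dS xy xe ye eX sS sS' UX; set_dec.
  have d1 : [disjoint X :\: e & (x |: S) :|: (y |: S')].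
    by clear -xe ye eX sS sS' UX; set_dec.
  have m2 := matchedU (erefl _) d2 (matched1 xS) (matched1 yS').
  have := maxX ((X :\: e) :|: ((x |: S) :|: (y |: S'))).
  rewrite (matchedU (erefl _) d1 mXe m2).
  have -> : (X :\: e) :|: ((x |: S) :|: (y |: S')) \subset ~: Z.
    by clear -xe ye eX sS sS' UZ sX; set_dec.
  rewrite (cardU_disjoint d1) (cardU_disjoint d2) (Gk xS) (Gk yS') cardsD (setIidPr eX).
  rewrite (Gk (subsetP sM _ eM)) => /(_ isT) /=; have := subset_leq_card eX.
  by rewrite (Gk (subsetP sM _ eM)); clear -k3; nlia.
have d12 : [disjoint S1 & S2] by clear -s2; set_dec.
have d13 : [disjoint S1 & S3] by clear -s3; set_dec.
have d23 : [disjoint S2 & S3] by clear -s3; set_dec.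
(* The three neighbourhoods have together at least [3 * (D - #|Z|)] incidences with [X], but each
   matching edge [e] carries at most [#|e|] of them. *)
have := cN _ s1 c1; have := cN _ sU2 c2; have := cN _ sU3 c3.
rewrite -cM -!trivIset_sum_cardI //.
have : (\sum_(e in M) #|e :&: nbr G S1| + \sum_(e in M) #|e :&: nbr G S2| +
   \sum_(e in M) #|e :&: nbr G S3| <= \sum_(e in M) #|e|)%N.
  rewrite -!big_split /=; apply: leq_sum => e eM.
  apply: card_three_stars; rewrite ?subsetIl ?(Gk (subsetP sM _ eM)) //; exact: clash.
have := max_card (mem (cover M)); rewrite -(eqP tM).
by clear -TD; nlia.
Qed.

End AlmostPerfect.

(** * Exchange and perfect matchings *)

Section Perfect.
Variables (T : finType) (G : {set {set T}}) (k D : nat).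
Implicit Types (A B W X Y Z P Q L S U : {set T}) (x y q : T).
Hypothesis k3 : 3 <= k.
Hypothesis Gk : forall e, e \in G -> #|e| = k.
Hypothesis GD : forall W, #|W| = k.-1 -> D <= #|nbr G W|.

(** Averaging over [w]: with [P] fixed, each [x] outside [P] forms an edge with [P] and at least
    [D - #|Z| - k] admissible vertices [w], a third of all vertices. Hence some [w] serves a third
    of [X :\: P], and [Q] is [w |: P]. *)
Lemma popular_edge X Z : #|T| + 3 * (#|Z| + k) <= 3 * D -> #|Z| + k <= #|T| ->
  exists Q q, [/\ q |: Q \in G, [disjoint q |: Q & Z], q \notin Q &
    3 * #|[set x in X | (x \notin Q) && (x |: Q \notin G)]| <= 2 * #|X|].
Proof.
move=> TD ZT; have [|P dP cP] := @exists_avoiding _ Z k.-2; first by clear -ZT; nlia.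
pose X1 := X :\: P; pose C := ~: (Z :|: P).
pose h w := #|[set x in X1 | x |: (w |: P) \in G]|.
have cC : 0 < #|C|.
  by have := cardsC (Z :|: P); rewrite -/C; have := leq_cardU Z P; clear -ZT cP k3; nlia.
have [w wC hw] : exists2 w, w \in C & #|X1| <= 3 * h w.
  case: (boolP [exists w, (w \in C) && (#|X1| <= 3 * h w)]).
    by move=> /existsP[w /andP[wC hw]]; exists w.
  move=> /existsPn nh'; have nh w : w \in C -> ~~ (#|X1| <= 3 * h w).
    by move=> wC; have := nh' w; rewrite wC.
  exfalso.
  have s1 : (\sum_(w in C) h w = \sum_(x in X1) #|[set w in C | w \in nbr G (x |: P)]|)%N.
    under eq_bigr do rewrite /h -sum1_card; rewrite (exchange_big_dep [in X1]) /=.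
      apply: eq_bigr => x xX; rewrite -sum1_card; apply: eq_bigl => w.
      by rewrite !inE setUCA; move: xX; rewrite !inE => ->.
    by move=> w x _; rewrite inE => /andP[].
  have s2 : #|X1| * (D - #|Z| - k) <= \sum_(w in C) h w.
    rewrite s1 -sum_nat_const; apply: leq_sum => x; rewrite in_setD => /andP[xP _].
    have cx : #|x |: P| = k.-1 by rewrite cardsU1 xP cP; clear -k3; nlia.
    have sC : [set w in C | w \in nbr G (x |: P)] = nbr G (x |: P) :\: (Z :|: P).
      by apply/setP => w; rewrite !inE.
    rewrite sC cardsD; have := subset_leq_card (subsetIr (nbr G (x |: P)) (Z :|: P)).
    by have := leq_cardU Z P; have := GD cx; rewrite cP; clear -k3; nlia.
  have s3 : 3 * (\sum_(w in C) h w) + #|C| <= #|C| * #|X1|.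
    rewrite big_distrr /= -sum1_card -big_split /= sum1_card -sum_nat_const.
    by apply: leq_sum => w /nh; rewrite -ltnNge addn1.
  have s4 : #|C| * #|X1| <= #|T| * #|X1| by rewrite leq_mul2r max_card orbT.
  have s5 : #|T| * #|X1| <= (3 * (D - #|Z| - k)) * #|X1|.
    by rewrite leq_mul2r; apply/orP; right; clear -TD; nlia.
  by clear -s2 s3 s4 s5 cC; nia.
have wP : w \notin P by move: wC; rewrite !inE negb_or => /andP[].
have wZ : w \notin Z by move: wC; rewrite !inE negb_or => /andP[].
have cQ : #|w |: P| = k.-1 by rewrite cardsU1 wP cP; clear -k3; nlia.
have [|q qN qZ] := nbr_avoiding k3 GD cQ (_ : #|Z| < D); first by clear -TD k3; nlia.
have qQ := nbr_notin k3 Gk cQ qN; rewrite inE in qN.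
exists (w |: P), q; split=> //; first by clear -dP wZ qZ; set_dec.
have : #|[set x in X | (x \notin w |: P) && (x |: (w |: P) \notin G)]| <= #|X1| - h w.
  have -> : h w = #|X1 :&: [set x | x |: (w |: P) \in G]| by apply: eq_card => x; rewrite !inE.
  rewrite -cardsD; apply: subset_leq_card; apply/subsetP => x; rewrite !inE negb_or -andbA.
  by case/and4P => -> _ -> ->.
have := subset_leq_card (subsetDl X P); rewrite -/X1; clear -hw; nlia.
Qed.

(** Each of [t] disjoint popular edges leaves at most two thirds of the vertices not yet served. [B]
    collects the replaceable vertices [q], one per edge; [X'] is what remains unserved. *)
Lemma exchange_layer t X Z : #|T| + 3 * (#|Z| + k * t + k) <= 3 * D ->
  #|Z| + k * t + k <= #|T| ->
  exists A B X', [/\ B \subset A, [disjoint A & Z], matched G A, #|A| <= k * t /\ #|B| <= t &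
    3 ^ t * #|X'| <= 2 ^ t * #|X| /\
    forall x, x \in X -> x \notin A ->
      x \in X' \/ exists2 q, q \in B & matched G (x |: (A :\ q))].
Proof.
elim: t X Z => [|t IHt] X Z TD ZT.
  exists set0, set0, X; rewrite !cards0 sub0set matched0 muln0; split=> //.
    by rewrite -setI_eq0 set0I.
  by split=> // x xX _; left.
have [||Q [q [qG dq qQ cX]]] := @popular_edge X Z; [by clear -TD; nlia|by clear -ZT; nlia|].
set X1 := [set x in X | _] in cX.
have cZq : #|Z :|: (q |: Q)| <= #|Z| + k.
  by have := leq_cardU Z (q |: Q); rewrite (Gk qG).
have [||A [B [X' [sB dA mA [cA cB] [cX' hX']]]]] := IHt X1 (Z :|: (q |: Q)).
- by clear -TD cZq; nlia.
- by clear -ZT cZq; nlia.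
have dAq : [disjoint A & q |: Q] by clear -dA; set_dec.
exists (A :|: (q |: Q)), (q |: B), X'; split.
- by clear -sB; set_dec.
- by clear -dA dq; set_dec.
- exact: matchedU (erefl _) dAq mA (matched1 qG).
- split; first by have := leq_cardU A (q |: Q); rewrite (Gk qG); clear -cA; nlia.
  by have := leq_cardU [set q] B; rewrite cards1; clear -cB; nlia.
split; first by rewrite !expnS; clear -cX cX'; nia.
move=> x xX xA; have [xQ xq xA'] : [/\ x \notin Q, x != q & x \notin A].
  by move: xA; rewrite !inE !negb_or => /and3P[].
case xG : (x |: Q \in G).
  right; exists q; first by rewrite setU11.
  apply: (matchedU _ _ (matched1 xG) mA); first by clear -dAq qQ; set_dec.
  by clear -xA' dAq; set_dec.
have [||?|[p pB mp]] := hX' x => //; first by rewrite inE xX xQ xG.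
  by left.
right; exists p; first by rewrite inE pB orbT.
have pA := subsetP sB _ pB.
apply: (matchedU _ _ mp (matched1 qG)); first by clear -pA dAq; set_dec.
by clear -dAq xQ xq; set_dec.
Qed.

(** The choice of [t] empties [X'], so one layer lets any single outside vertex in at the price of a
    vertex of [B]. With [r] disjoint layers, [r] vertices are exchanged, one per layer. *)
Lemma exchange_layers t r Z : 2 ^ t * #|T| < 3 ^ t ->
  #|T| + 3 * (#|Z| + r * (k * t) + k) <= 3 * D -> #|Z| + r * (k * t) + k <= #|T| ->
  exists A B, [/\ B \subset A, [disjoint A & Z], matched G A, #|A| <= r * (k * t) /\ #|B| <= r * t &
    forall U, [disjoint U & A] -> #|U| <= r ->
      exists L, [/\ L \subset B, #|L| = #|U| & matched G (U :|: (A :\: L))]].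
Proof.
move=> t23; elim: r Z => [|r IHr] Z TD ZT.
  exists set0, set0; rewrite !cards0 sub0set matched0; split=> //.
    by rewrite -setI_eq0 set0I.
  move=> U _; rewrite leqn0 cards_eq0 => /eqP ->; exists set0.
  by rewrite sub0set setD0 setU0 matched0.
have [||A [B [sB dA mA [cA cB] h]]] := IHr Z; [by clear -TD; nlia|by clear -ZT; nlia|].
have cZA := leq_cardU Z A.
have [||A1 [B1 [X' [sB1 dA1 mA1 [cA1 cB1] [cX' h1]]]]] := @exchange_layer t setT (Z :|: A).
- by clear -TD cZA cA; nlia.
- by clear -ZT cZA cA; nlia.
have X0 : X' = set0.
  apply/eqP; rewrite -cards_eq0; apply/negPn/negP; rewrite -lt0n => X0.
  by move: cX'; rewrite cardsT; clear -X0 t23; nia.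
have dAA : [disjoint A1 & A] by clear -dA1; set_dec.
exists (A :|: A1), (B :|: B1); split.
- by clear -sB sB1; set_dec.
- by clear -dA dA1; set_dec.
- by apply: matchedU mA mA1; rewrite // disjoint_sym.
- have := leq_cardU A A1; have := leq_cardU B B1; clear -cA cA1 cB cB1; nlia.
move=> U dU cU; have [->|/set0Pn[u uU]] := eqVneq U set0.
  exists set0; rewrite sub0set cards0 setD0 set0U; split=> //.
  by apply: matchedU mA mA1; rewrite // disjoint_sym.
have cUu : #|U| = #|U :\ u|.+1 by rewrite (cardsD1 u) uU.
have [||L [sL cL mL]] := h (U :\ u); [by clear -dU; set_dec|by clear -cU cUu; nlia|].
have [|u0|[q qB mq]] := h1 u (in_setT u).
- by clear -dU uU; apply/negP => uA; have := disjoint_at dU u; rewrite !inE uU uA orbT.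
- by move: u0; rewrite X0 inE.
have qA := subsetP sB1 _ qB.
have qnA : q \notin A by rewrite (disjointFr dAA qA).
have sLA : L \subset A := subset_trans sL sB.
have qL : q \notin L by apply: contra qnA; apply: (subsetP sLA).
exists (q |: L); split.
- by clear -sL qB; set_dec.
- by rewrite cardsU1 qL cL cUu.
apply: (matchedU _ _ mL mq).
  by clear -qA qnA sLA dAA uU; set_dec.
by clear -dAA dU uU sLA; set_dec.
Qed.

Lemma absorb_all m s (Ls : seq {set T}) Z : #|Z| + s * size Ls <= m ->
  exists Y, [/\ [disjoint Y & Z], #|Y| <= s * size Ls, matched G Y &
    forall L, L \in Ls -> absorbable G m s L -> L \subset Z -> matched G (L :|: Y)].
Proof.
elim: Ls Z => [|L Ls IH] Z cZ.
  by exists set0; rewrite cards0 matched0; split=> //; rewrite -setI_eq0 set0I.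
have [|Y [dY cY mY hY]] := IH Z; first by move: cZ; rewrite /= mulnS; clear; nlia.
case aL : (absorbable G m s L); last first.
  exists Y; split=> //; first by rewrite (leq_trans cY) //= mulnS leq_addl.
  by move=> L'; rewrite inE => /orP[/eqP->|/hY//]; rewrite aL.
move/absorbableP: aL => /(_ (Z :|: Y)) [].
  by move: cZ; have := leq_cardU Z Y; rewrite /= mulnS; clear -cY; nlia.
move=> X [cX dX mX mXL].
have dXY : [disjoint X & Y] by clear -dX; set_dec.
exists (X :|: Y); split.
- by clear -dX dY; set_dec.
- by have := leq_cardU X Y; rewrite /= mulnS; clear -cX cY; nlia.
- exact: matchedU mX mY.
move=> L'; rewrite inE => /orP[/eqP-> _ sL|LL aL sL].
  by apply: matchedU mXL mY; [clear; set_dec | clear -dXY dY sL; set_dec].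
by apply: (matchedU _ _ (hY _ LL aL sL) mX); [clear; set_dec | clear -dX sL; set_dec].
Qed.

(* [e0] is kept aside as a toggle: a leftover [L] of the wrong parity is
   replaced by [L :|: e0]. *)
Lemma perfect_matched t m s (e0 : {set T}) :
  2 ^ t * #|T| < 3 ^ t -> k %| #|T| -> #|T| + 3 * (m + k) <= 3 * D -> m + k <= #|T| ->
  k + 3 * k * (k * t) + s * (2 * (3 * k * t).+1 ^ (3 * k)) <= m ->
  #|e0| <= k -> matched G e0 ->
  (forall L, [disjoint L & e0] -> #|L| < 3 * k -> matched G (~: L) ->
     absorbable G m s L || absorbable G m s (L :|: e0)) ->
  matched G setT.
Proof.
move=> t23 kT TD mT mm ce me habs.
have [||A [B [sB dA mA [cA cB] hA]]] := @exchange_layers t (3 * k) e0 t23.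
- by clear -TD mm ce; nlia.
- by clear -mT mm ce; nlia.
(* All leftovers the exchange can produce, with and without [e0], are provided for before the greedy
   matching determines the actual one. *)
pose LL := [set L : {set T} | (L \subset B) && (#|L| <= 3 * k)].
pose Ls := enum LL ++ [seq L :|: e0 | L : {set T} in LL].
have cLs : size Ls <= 2 * (3 * k * t).+1 ^ (3 * k).
  rewrite size_cat size_image -cardE mul2n -addnn.
  have : #|LL| <= (3 * k * t).+1 ^ (3 * k).
    by apply: leq_trans (few_subsets _ _) _; rewrite leq_exp2r // ?ltnS // muln_gt0 /=; clear -k3; nlia.
  by clear; nlia.
have cZ : #|e0 :|: A| <= k + 3 * k * (k * t) by have := leq_cardU e0 A; clear -cA ce; nlia.
have csL : s * size Ls <= s * (2 * (3 * k * t).+1 ^ (3 * k)) by rewrite leq_mul2l cLs orbT.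
have [|Y [dY cY mY hY]] := @absorb_all m s Ls (e0 :|: A); first exact: leq_trans (leq_add cZ csL) mm.
have cZY : #|e0 :|: A :|: Y| <= m.
  by apply: leq_trans (leq_cardU _ _) (leq_trans (leq_add cZ (leq_trans cY csL)) mm).
have [|X [mX sX cU]] := @almost_perfect _ _ _ _ k3 Gk GD (e0 :|: A :|: Y); first by clear -TD cZY k3; nlia.
set U := ~: (_ :|: X) in cU.
have [dUX dU] : [disjoint U & X] /\ [disjoint U & e0 :|: A :|: Y].
  by rewrite /U; clear; split; set_dec.
have dX : [disjoint X & e0 :|: A :|: Y] by rewrite disjoints_subset.
have UT : setT = e0 :|: A :|: Y :|: X :|: U.
  by apply/setP => z; rewrite !inE; case: (z \in e0); case: (z \in A); case: (z \in Y); case: (z \in X).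
clearbody U.
(* The uncovered set [U] is traded for a set [L] inside [B], for which an absorber has been
   reserved. *)
have [||L [sL cL mL]] := hA U; [by clear -dU; set_dec|by clear -cU; nlia|].
have sLA := subset_trans sL sB.
have dUe : [disjoint U :|: (A :\: L) & e0] by clear -dU dA; set_dec.
have dUe' : [disjoint U :|: (A :\: L) & e0 :|: L] by clear -dU dA sLA; set_dec.
have dUY : [disjoint U :|: (A :\: L) & Y] by clear -dU dY; set_dec.
have m1 : matched G (X :|: (U :|: (A :\: L))).
  by apply: matchedU mX mL => //; clear -dX dUX; set_dec.
have dY1 : [disjoint Y & X :|: (U :|: (A :\: L))] by clear -dY dX dU; set_dec.
have de1 : [disjoint e0 & X :|: (U :|: (A :\: L))] by clear -dY dX dU dA; set_dec.
have dL1 : [disjoint L & X :|: (U :|: (A :\: L))] by clear -dX dU sLA; set_dec.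
have deY : [disjoint e0 & Y] by clear -dY; set_dec.
have dLY : [disjoint L & Y] by clear -dY sLA; set_dec.
have dLe : [disjoint L & e0] by clear -dA sLA; set_dec.
have mC : matched G (~: L).
  apply: (@matchedU _ _ _ (Y :|: e0) (X :|: (U :|: (A :\: L)))) => //.
  - apply/setP => z; have := in_setT z; rewrite {1}UT; clear -dLY dLe dL1 sLA; at_point z.
  - by clear -dY1 de1; set_dec.
  - by apply: matchedU mY me => //; rewrite disjoint_sym.
have cL' : #|L| < 3 * k by rewrite cL; clear -cU k3; nlia.
have LLL : L \in LL by rewrite inE sL ltnW.
(* In the first case [e0] keeps its own matching; in the second it is absorbed together with [L]. *)
case/orP: (habs L dLe cL' mC) => aL.
- have mLY : matched G (L :|: Y).
    apply: hY aL _; first by rewrite mem_cat mem_enum LLL.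
    by clear -sLA; set_dec.
  apply: (@matchedU _ _ _ (L :|: Y :|: e0) (X :|: (U :|: (A :\: L)))) => //.
  + by rewrite UT; clear -sLA; set_dec.
  + by clear -dY1 de1 dL1; set_dec.
  + by apply: matchedU mLY me => //; clear -deY dLe; set_dec.
- have mLY : matched G (L :|: e0 :|: Y).
    apply: hY aL _; last by clear -sLA; set_dec.
    by rewrite mem_cat; apply/orP; right; apply/imageP; exists L.
  apply: (@matchedU _ _ _ (L :|: e0 :|: Y) (X :|: (U :|: (A :\: L)))) => //.
  + by rewrite UT; clear -sLA; set_dec.
  + by clear -dY1 de1 dL1; set_dec.
Qed.

End Perfect.

(** * The parity dichotomy *)

Section Dichotomy.
Variables (T : finType) (G : {set {set T}}) (k D : nat).
Implicit Types (A B E W X Y Z P Q L S U V : {set T}) (x y q : T).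
Hypothesis k3 : 3 <= k.
Hypothesis Gk : forall e, e \in G -> #|e| = k.
Hypothesis GD : forall W, #|W| = k.-1 -> D <= #|nbr G W|.

(** If [Z1] and [Z2] destroyed both types, take [i] vertices of [A] and [k.-1 - i] of [B] off them.
    A completing vertex off [Z1] and [Z2] gives an edge of type [i] or [i.+1]. *)
Lemma robust_step V A B m i : A \subset V -> [disjoint B & V] ->
  2 * m + k <= #|A| -> 2 * m + k <= #|B| -> 2 * m < D -> i < k ->
  robust G V m i || robust G V m i.+1.
Proof.
move=> sA dB cA cB mD ik; apply/negPn/negP; rewrite negb_or => /andP[].
have neg j : ~~ robust G V m j -> exists2 Z : {set T}, #|Z| <= m &
    forall e, e \in G -> [disjoint e & Z] -> #|e :&: V| != j.
  move=> /forallPn[Z]; rewrite negb_imply => /andP[cZ /existsPn h]; exists Z => // e eG dZ.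
  by have := h e; rewrite eG dZ.
move=> /neg[Z1 c1 h1] /neg[Z2 c2 h2].
have cZ : #|Z1 :|: Z2| <= 2 * m by have := leq_cardU Z1 Z2; clear -c1 c2; nlia.
have sub E j : 2 * m + k <= #|E| -> j < k ->
    exists2 P : {set T}, P \subset E :\: (Z1 :|: Z2) & #|P| = j.
  move=> cE jk; apply: exists_subset; rewrite cardsD.
  by have := subset_leq_card (subsetIr E (Z1 :|: Z2)); clear -cE cZ jk; nlia.
have [P1 sP1 cP1] := sub _ _ cA ik.
have [|P2 sP2 cP2] := sub _ (k.-1 - i) cB; first by clear -k3; nlia.
have d12 : [disjoint P1 & P2] by clear -sP1 sP2 sA dB; set_dec.
have cP : #|P1 :|: P2| = k.-1 by rewrite cardU_disjoint // cP1 cP2; clear -ik; nlia.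
have [v vN vZ] := nbr_avoiding k3 GD cP (leq_ltn_trans cZ mD).
have vP := nbr_notin k3 Gk cP vN; rewrite inE in vN.
have P12V : (P1 :|: P2) :&: V = P1 by clear -sP1 sP2 sA dB; set_dec.
have := h1 _ vN; have := h2 _ vN; rewrite setIUl P12V.
have -> : [disjoint v |: (P1 :|: P2) & Z1] by clear -vZ sP1 sP2; set_dec.
have -> : [disjoint v |: (P1 :|: P2) & Z2] by clear -vZ sP1 sP2; set_dec.
move=> /(_ isT) + /(_ isT); case vV : (v \in V).
  rewrite (setIidPl _) ?sub1set // cardsU1.
  have -> : v \notin P1 by move: vP; rewrite inE negb_or => /andP[].
  by rewrite cP1 eqxx.
have -> : [set v] :&: V = set0 by apply/setP => z; rewrite !inE; case: eqP => // ->; rewrite vV.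
by rewrite set0U cP1 eqxx.
Qed.

(** The types 0 to 3 decide this, and [3 <= k] makes the alternation reach them. *)
Lemma robust_parity V m : (forall i, i < k -> robust G V m i.+1 = ~~ robust G V m i) ->
  exists a : bool, robust G V m a && robust G V m a.+2.
Proof.
move=> alt; case r0 : (robust G V m 0); [exists false | exists true].
- by rewrite r0 alt ?alt ?r0 //; clear -k3; nlia.
- by rewrite !alt ?r0 //; clear -k3; nlia.
Qed.

(** A set of [k.-1] vertices is completed only inside [V] if its count in [V] has the parity other
    than [a], and only outside [V] if it has parity [a]. Sets with 0 or 1 vertices in [V] give both
    bounds. *)
Lemma all_edges_parity V (a : bool) : k <= #|V| -> k <= #|~: V| ->
  (forall e, e \in G -> odd #|e :&: V| = a) -> D <= #|V| /\ D <= #|~: V|.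
Proof.
move=> cV cV' Ga.
have pick (i : bool) : exists P, [/\ #|P| = k.-1 & #|P :&: V| = i].
  have [|P1 s1 c1] := @exists_subset _ V i; first by clear -k3 cV; case: i; nlia.
  have [|P2 s2 c2] := @exists_subset _ (~: V) (k.-1 - i); first by clear -cV'; nlia.
  have d12 : [disjoint P1 & P2] by clear -s1 s2; set_dec.
  exists (P1 :|: P2); split; first by rewrite cardU_disjoint // c1 c2; clear -k3; case: i; nlia.
  by have -> : (P1 :|: P2) :&: V = P1 by clear -s1 s2; set_dec.
have par P v : #|P| = k.-1 -> v \in nbr G P -> (v \in V) (+) odd #|P :&: V| = a.
  move=> cP vN; have vP := nbr_notin k3 Gk cP vN; rewrite inE in vN.
  rewrite -(Ga _ vN) setIUl; case vV : (v \in V).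
    have -> : [set v] :&: V = [set v] by apply/setIidPl; rewrite sub1set.
    by rewrite cardsU1 inE (negPf vP).
  have -> : [set v] :&: V = set0 by apply/setP => z; rewrite !inE; case: eqP => // ->; rewrite vV.
  by rewrite set0U.
split.
  have [P [cP iP]] := pick (~~ a); apply: leq_trans (GD cP) _; apply: subset_leq_card.
  by apply/subsetP => v /(par _ _ cP); rewrite iP; case: (v \in V); case: (a).
have [P [cP iP]] := pick a; apply: leq_trans (GD cP) _; apply: subset_leq_card.
by apply/subsetP => v /(par _ _ cP); rewrite iP inE; case: (v \in V); case: (a).
Qed.

Lemma leftover_dvdn L : (k %| #|T|) -> #|L| < 3 * k -> matched G (~: L) ->
  exists2 r, r <= 2 & #|L| = (k * r)%N.
Proof.
move=> kT cL /(dvdn_matched Gk); move=> h; move: kT; rewrite -(cardsC L).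
rewrite dvdn_addl // => /dvdnP[r rL]; exists r.
  by move: cL; rewrite rL ltn_pmul2r //; clear -k3; nlia.
by rewrite mulnC.
Qed.

Section Constants.
(* Pairs of one class are linked by at most [s2] vertices, all pairs after a
   merge by at most [s3], and an absorber has at most [S0] vertices; [m0], [m2],
   [m3] and [M] bound the sets to be avoided at the successive stages. *)
Let s2 := 4 * k.
Let s3 := k.+1 * s2 + 2 * k.
Let S0 := 4 * (k * (k.+2 * 3)) + k * (k.+2 * 3) * s3 + k * 3.

Variables (t M : nat).
Hypothesis t23 : 2 ^ t * #|T| < 3 ^ t.
Hypothesis MS : k + 3 * k * (k * t) + S0 * (2 * (3 * k * t).+1 ^ (3 * k)) <= M.
Let m3 := M + S0.
Let m2 := m3 + 4 * k + 4 + k.+1 * s2.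
Let m0 := m2 + 3 * k + 4.
Hypothesis TD : #|T| + 9 * m0 + 3 * k < 3 * D.
Hypothesis Tm : 18 * (m0 * k) + 18 * k <= #|T|.
Hypothesis kT : k %| #|T|.

(** With the empty set as [V] there is one class and every edge has type 0, so a leftover of [k * r]
    vertices is linked to [r] edges. The toggle is empty here. *)
Lemma perfect_of_linked : (forall x y, linked G m3 s3 x y) -> matched G setT.
Proof.
move=> lk.
have big : [&& 3 * (M + k) + #|T| <= 3 * D, M + k <= #|T|, m3 < D & m3 + k < #|T|].
  have mm : m3 <= m0 by rewrite /m0 /m2; clear; nlia.
  have mk : m0 <= m0 * k by apply: leq_pmulr; clear -k3; nlia.
  have MM : M <= m3 by rewrite leq_addr.
  by clear -mm mk MM TD Tm k3; apply/and4P; split; nlia.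
case/and4P: big => b1 b2 b3 b4.
have r0 : robust G set0 m3 0.
  apply/robustP => Z cZ; have [|x xZ] := @exists_notin _ Z; first by clear -cZ b4; nlia.
  have [||W [_ dW xW]] := link_avoiding k3 Gk GD x (Z := Z).
  - by clear -cZ b3; nlia.
  - by clear -cZ b4; nlia.
  by exists (x |: W); split=> //; [clear -dW xZ; set_dec | rewrite setI0 cards0].
apply: (perfect_matched k3 Gk GD t23 kT _ b2 MS (e0 := set0)).
- by rewrite addnC.
- by rewrite cards0.
- exact: matched0.
move=> L _ cL mL; apply/orP; left; have [r r2 cLr] := leftover_dvdn kT cL mL.
apply: (@absorbable_types _ _ _ Gk set0 m3 s3 (fun x y _ => lk x y) (nseq r 0) [::]).
- by rewrite all_nseq r0 orbT.
- by [].
- by rewrite size_nseq cLr muln0 addn0.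
- by rewrite setI0 cards0 sumn_nseq.
- rewrite size_nseq cLr /m3 /S0 /=.
  have : k * r <= k * 2 by rewrite leq_mul2l r2 orbT.
  have : k * r * s3 <= k * (k.+2 * 3) * s3.
    by rewrite leq_mul2r; apply/orP; right; rewrite leq_mul2l; clear -r2; nlia.
  by clear; nlia.
- rewrite size_nseq /S0 /=.
  have : k * r <= k * 2 by rewrite leq_mul2l r2 orbT.
  have : k * r * s3 <= k * (k.+2 * 3) * s3.
    by rewrite leq_mul2r; apply/orP; right; rewrite leq_mul2l; clear -r2; nlia.
  by clear; nlia.
Qed.

(** If [L] has the wrong parity for its size, then so does [e0] for one edge, and the two errors
    cancel in [L :|: e0]. As [L] has at most [2 * k] vertices, at most [3 * k] are absorbed. *)
Lemma perfect_of_bad_edge V (a : bool) e0 :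
  (forall x y, (x \in V) = (y \in V) -> linked G m2 s2 x y) ->
  robust G V m2 a -> robust G V m2 a.+2 -> e0 \in G -> odd #|e0 :&: V| != a ->
  matched G setT.
Proof.
move=> lk ra ra2 e0G bad.
have big : (3 * (M + k) + #|T| <= 3 * D) && (M + k <= #|T|).
  have mm : M <= m0 by rewrite /m0 /m2 /m3; clear; nlia.
  have mk : m0 <= m0 * k by apply: leq_pmulr; clear -k3; nlia.
  by clear -mm mk TD Tm k3; apply/andP; split; nlia.
case/andP: big => b1 b2.
apply: (perfect_matched k3 Gk GD t23 kT _ b2 MS (e0 := e0)).
- by rewrite addnC.
- by rewrite (Gk e0G).
- exact: matched1.
move=> L dL cL mL; have [r r2 cLr] := leftover_dvdn kT cL mL.
have absorb r' L' : r' <= 3 -> #|L'| = (k * r')%N -> odd #|L' :&: V| = a && odd r' ->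
    absorbable G M S0 L'.
  move=> r3 cL' oL'; apply: (absorbable_parity Gk lk ra ra2 cL' oL').
    have h1 : k * r' <= k * 3 by rewrite leq_mul2l r3 orbT.
    have h2 : k * (k.+1 * r') <= k * (k.+2 * 3).
      by rewrite leq_mul2l; apply/orP; right; apply: leq_mul.
    have h3 : k * (k.+2 * r') <= k * (k.+2 * 3).
      by rewrite leq_mul2l; apply/orP; right; apply: leq_mul.
    have h4 : k * (k.+2 * r') * s2 <= k * (k.+2 * 3) * s3.
      by apply: leq_mul h3 _; rewrite /s3 mulSn -addnA leq_addr.
    by rewrite /m2 /m3 /S0; clear -h1 h2 h3 h4; nlia.
  have h2 : k * (k.+1 * r') <= k * (k.+2 * 3).
    by rewrite leq_mul2l; apply/orP; right; apply: leq_mul.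
  have h3 : k * (k.+2 * r') <= k * (k.+2 * 3).
    by rewrite leq_mul2l; apply/orP; right; apply: leq_mul.
  have h4 : k * (k.+2 * r') * s2 <= k * (k.+2 * 3) * s3.
    by apply: leq_mul h3 _; rewrite /s3 mulSn -addnA leq_addr.
  by rewrite /S0; clear -h2 h3 h4; nlia.
have [oL|oL] := eqVneq (odd #|L :&: V|) (a && odd r).
  by rewrite (absorb r L) // ltnW.
apply/orP; right; apply: (absorb r.+1) => //.
- by rewrite cardU_disjoint // cLr (Gk e0G) mulnS addnC.
have dV : [disjoint L :&: V & e0 :&: V] by clear -dL; set_dec.
rewrite setIUl cardU_disjoint // oddD /=.
by move: oL bad; case: (odd #|L :&: V|); case: (odd #|e0 :&: V|); case: (a); case: (odd r).
Qed.

Lemma perfect_or_parity : matched G setT \/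
  exists V (a : bool), [/\ forall e, e \in G -> odd #|e :&: V| = a, D <= #|V| & D <= #|~: V|].
Proof.
have mk : m0 <= m0 * k by apply: leq_pmulr; clear -k3; nlia.
have m0E : m0 = m2 + 3 * k + 4 by [].
have Dm : 6 * m0 * k.-1 < D.
  have : m0 * k.-1 <= m0 * k by rewrite leq_mul2l leq_pred orbT.
  by clear -TD Tm k3; nlia.
have mm1 : m0 * k.-1 <= m0 * k by rewrite leq_mul2l leq_pred orbT.
pose R := colinked G k m0.
have R3 x y z : [|| R x y, R x z | R y z].
  by apply: (colinked_triple k3 Gk GD); [clear -TD; nlia | clear -Tm mk k3; nlia].
have Rdeg x : #|T| %/ 6 <= #|[set z | R x z]|.
  have := colinked_degree k3 Gk GD x (m := m0) _ _ Dm _; rewrite -/R.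
  move=> h; have {}h : #|T| <= 6 * #|[set y | R x y]|.
    by apply: h; [clear -m0E; nlia | clear -TD; nlia | clear -mm1 Tm k3; nlia].
  by clear -h; nlia.
have Tm6 : 3 * m0 <= #|T| %/ 6 by clear -Tm mk; nlia.
(* Links are composed twice: from [k.-1] to [s1] vertices through common [R]-neighbours, and from
   [s1] to at most [s2] through [A] or [B]. *)
pose m1 := m2 + 2 * k + 2; pose s1 := 2 * k.-1 + 1.
have lk1 x y : m0 <= #|[set z | R x z && R z y]| -> linked G m1 s1 x y.
  move=> h; apply: (linked_trans (m := m0) (s := k.-1) (C := [set z | R x z && R z y])).
  - by move=> z; rewrite inE => /andP[xz zy]; split; apply: colinked_linked.
  - by apply: leq_trans h; rewrite /m1 m0E; clear -k3; nlia.
  - by rewrite /m1 m0E; clear -k3; nlia.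
have m12 : m2 + s1 + 3 <= m1 by rewrite /m1 /s1; clear -k3; nlia.
have s12 : 2 * s1 + 1 <= s2 by rewrite /s1 /s2; clear -k3; nlia.
have m2m3 : m3 + 2 * k + 2 + 2 * k.+1 + k.+1 * s2 <= m2 by rewrite /m2; clear; nlia.
have [all1|[V [A [B [sA dB cA cB [lA lB]]]]]] :=
    dominating_partition (colinkedC G k m0) R3 Rdeg Tm6.
  left; apply: perfect_of_linked => x y; case/orP: (all1 x y) => [/colinked_linked|/lk1] h.
    apply: linkedW h; first by rewrite m0E; clear -m2m3; nlia.
    by rewrite /s3 /s2; clear -k3; nlia.
  apply: linkedW h; first by clear -m2m3 m12; nlia.
  by rewrite /s3; clear -s12; nlia.
have lk2 E x y : m0 + 3 <= #|E| -> (forall b, b \in E -> linked G m1 s1 x b) ->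
    (forall b, b \in E -> linked G m1 s1 y b) -> linked G m2 s2 x y.
  move=> cE xE yE; apply: (linkedW (leqnn m2) s12).
  apply: (linked_trans (C := E) _ _ m12); last by rewrite m0E in cE; clear -cE; nlia.
  by move=> z zE; split; [apply: xE | apply: linkedC; apply: yE].
have cA' : 2 * m0 <= #|A| by clear -cA Tm6; nlia.
have cB' : 2 * m0 <= #|B| by clear -cB Tm6; nlia.
have lV x y : (x \in V) = (y \in V) -> linked G m2 s2 x y.
  case xV : (x \in V) => yV.
    apply: (lk2 A); first by rewrite m0E in cA' *; clear -cA'; nlia.
    - by move=> b bA; apply/lk1/lA.
    - by move=> b bA; apply/lk1/lA.
  apply: (lk2 B); first by rewrite m0E in cB' *; clear -cB'; nlia.
  - by move=> b bB; apply/lk1/lB; rewrite ?xV.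
  - by move=> b bB; apply/lk1/lB; rewrite -?yV.
case: (boolP [exists i : 'I_k, robust G V m2 i && robust G V m2 i.+1]).
  move=> /existsP[i /andP[ri ri1]]; left; apply: perfect_of_linked.
  exact: (linked_transferral Gk lV ri ri1 m2m3).
(* Consecutive types are now never both robust, and by [robust_step] never both fragile, so they
   alternate. *)
move=> /existsPn alt.
have [|a /andP[ra ra2]] := @robust_parity V m2.
  move=> i ik; have := alt (Ordinal ik); rewrite negb_and /=.
  have := @robust_step V A B m2 i sA dB _ _ _ ik.
  case: (robust G V m2 i) => /=; first by move=> _ /negPf.
  move=> h _; apply: h.
  - by rewrite m0E in cA'; clear -cA'; nlia.
  - by rewrite m0E in cB'; clear -cB'; nlia.
  - by move: TD; rewrite m0E; clear; nlia.
case: (boolP [exists e in G, odd #|e :&: V| != a]).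
  by move=> /exists_inP[e eG bad]; left; apply: (perfect_of_bad_edge lV ra ra2 eG bad).
move=> /exists_inPn good; right; exists V, a.
have Ga e : e \in G -> odd #|e :&: V| = a by move=> /good/negPn/eqP.
have cV := subset_leq_card sA; have cV' : #|B| <= #|~: V|.
  by apply: subset_leq_card; rewrite -disjoints_subset.
have [||] := @all_edges_parity V a _ _ Ga; last by [].
  by rewrite m0E in cA'; clear -cA' cV; nlia.
by rewrite m0E in cB'; clear -cB' cV'; nlia.
Qed.

End Constants.
End Dichotomy.

(** * Size thresholds *)

Lemma leq_wexp2r d a b : a <= b -> a ^ d <= b ^ d.
Proof. by case: d => // d ab; rewrite leq_exp2r. Qed.

(** With [q] the quotient of [l] by [d.+1], one has [l <= d.+1 * q.+1] and [q.+1 <= 2 ^ q], which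
    bounds [l ^ d] by [d.+1 ^ d * 2 ^ (q * d)]. One more factor [2 ^ q] pays for the constants. *)
Lemma exp2_dominates_poly C d : exists l0, forall l, l0 <= l -> C * l ^ d <= 2 ^ l.
Proof.
exists (d.+1 * (C * d.+1 ^ d)) => l hl; pose q := l %/ d.+1.
have hq : C * d.+1 ^ d <= q by rewrite leq_divRL // mulnC.
have lq : l <= d.+1 * q.+1 by rewrite mulnC ltnW // -ltn_divLR.
have lqd : l ^ d <= d.+1 ^ d * 2 ^ (q * d).
  apply: leq_trans (_ : (d.+1 * q.+1) ^ d <= _); first exact: leq_wexp2r.
  rewrite expnMn expnM leq_mul2l; apply/orP; right.
  by apply: leq_wexp2r; apply: ltn_expl.
apply: leq_trans (_ : 2 ^ (q + q * d) <= _); last by rewrite leq_exp2l // -mulnS leq_trunc_div.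
rewrite expnD; apply: leq_trans (leq_mul (leqnn C) lqd) _.
rewrite mulnA leq_mul2r; apply/orP; right; apply: leq_trans hq _.
by rewrite ltnW // ltn_expl.
Qed.

(* [t = 2 l] with [n < 2 ^ l], since [8 ^ l <= 9 ^ l]. *)
Lemma logarithmic_layers k S C : 3 <= k -> exists n0, forall n, n0 <= n -> exists t,
  2 ^ t * n < 3 ^ t /\ C * (k + 3 * k * (k * t) + S * (2 * (3 * k * t).+1 ^ (3 * k))) <= n.
Proof.
(* For [t = 2 * l] the base of the power is at most [7 * k * l], and the lower-order terms are
   absorbed in [2 * k + 2 * S]. The leading 2 comes from [2 ^ l <= 2 * n]. *)
move=> k3; pose E := 2 * (C * (2 * k + 2 * S) * (7 * k) ^ (3 * k)).
have [l0 hl0] := exp2_dominates_poly E (3 * k).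
exists (2 ^ l0) => n hn; pose l := (trunc_log 2 n).+1.
have n0 : 0 < n by apply: leq_trans hn; rewrite expn_gt0.
have ln : n < 2 ^ l by apply: trunc_log_ltn.
have nl : 2 ^ l <= 2 * n by rewrite expnS leq_mul2l trunc_logP.
have ll : l0 <= l by rewrite ltnW // ltnS; apply: trunc_log_max.
exists (2 * l); split.
  rewrite !expnM; apply: leq_trans (_ : 4 ^ l * 2 ^ l <= _); first by rewrite ltn_pmul2l // expn_gt0.
  by rewrite -expnMn leq_wexp2r.
have := hl0 l ll => h; have {nl}h := leq_trans h nl.
pose x := (3 * k * (2 * l)).+1.
have xl : x <= 7 * k * l by rewrite /x /l; clear -k3; nia.
have xx : x <= x ^ (3 * k) by rewrite -{1}[x]expn1 leq_exp2l //; rewrite /x /l; clear -k3; nia.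
have xe : x ^ (3 * k) <= (7 * k) ^ (3 * k) * l ^ (3 * k).
  by rewrite -expnMn leq_wexp2r.
rewrite -/x; set y := x ^ (3 * k) in xx xe *.
have b : k + 3 * k * (k * (2 * l)) + S * (2 * y) <= (2 * k + 2 * S) * y.
  have : 3 * k * (2 * l) <= x by rewrite /x.
  move=> h1; have h2 : k * (3 * k * (2 * l)) <= k * y by rewrite leq_mul2l (leq_trans h1 xx) orbT.
  have h3 : k <= k * y by rewrite leq_pmulr //; apply: leq_trans xx.
  by clear -h2 h3; nia.
have b2 : (2 * k + 2 * S) * y <= (2 * k + 2 * S) * ((7 * k) ^ (3 * k) * l ^ (3 * k)).
  by rewrite leq_mul2l xe orbT.
rewrite -(leq_pmul2l (isT : 0 < 2)); apply: leq_trans h.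
have -> : E * l ^ (3 * k) = 2 * (C * ((2 * k + 2 * S) * ((7 * k) ^ (3 * k) * l ^ (3 * k)))).
  by rewrite /E !mulnA.
by rewrite leq_mul2l /= leq_mul2l (leq_trans b b2) orbT.
Qed.

(** The density bound, [D] at least [1/3 + 1/(3K)] times the number of vertices, is stated without
    fractions. *)
Lemma perfect_or_parity_large k K : 3 <= k -> 0 < K -> exists n0,
  forall (T : finType) (G : {set {set T}}) D, n0 <= #|T| -> (k %| #|T|) ->
    (forall e, e \in G -> #|e| = k) -> (forall W : {set T}, #|W| = k.-1 -> D <= #|nbr G W|) ->
    K.+1 * #|T| <= 3 * K * D ->
  matched G setT \/ exists (V : {set T}) (a : bool),
    [/\ forall e, e \in G -> odd #|e :&: V| = a, D <= #|V| & D <= #|~: V|].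
Proof.
move=> k3 K0; pose s2 := 4 * k; pose s3 := k.+1 * s2 + 2 * k.
pose S0 := 4 * (k * (k.+2 * 3)) + k * (k.+2 * 3) * s3 + k * 3.
(* [g] is the part of [m0] beyond [M], so [m0 = M + g <= g.+1 * M]. [C] adds up what the two size
   hypotheses of [perfect_or_parity] require, the first one multiplied by [K]. *)
pose g := S0 + 4 * k + 4 + k.+1 * s2 + 3 * k + 4.
pose C := (18 * k + 9 * K) * g.+1 + 18 * k + K * (3 * k).+1.
have [n0 h] := logarithmic_layers S0 C k3.
exists n0 => T G D nT kT Gk GD KD; have [t [t23]] := h _ nT.
set M := k + _ + _ => CM.
have M1 : 0 < M by rewrite /M; clear -k3; nlia.
have mg : M + S0 + 4 * k + 4 + k.+1 * s2 + 3 * k + 4 = M + g by rewrite /g; clear; nlia.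
have gM : M + g <= g.+1 * M by rewrite mulSn leq_add2l leq_pmulr.
have : (18 * k + 9 * K) * (M + g) + (18 * k + K * (3 * k).+1) <= #|T|.
  have b1 : (18 * k + 9 * K) * (M + g) <= (18 * k + 9 * K) * (g.+1 * M).
    by rewrite leq_mul2l gM orbT.
  have b2 := leq_pmulr (18 * k + K * (3 * k).+1) M1.
  apply: leq_trans (leq_add b1 b2) _.
  by rewrite [X in X + _ <= _]mulnA -mulnDl addnA.
move=> bound; apply: (perfect_or_parity k3 Gk GD t23 (leqnn _) _ _ kT);
  rewrite -/M -/s2 -/s3 -/S0 mg; move: (M + g) bound KD => X; move: K0 #|T|.
  clear; move=> K0 N b1 b2; rewrite -(ltn_pmul2l K0).
  have : 0 <= 18 * k * X by [].
  by move: b1 b2; clear -K0; nia.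
by clear; move=> _ N b1 _; nia.
Qed.

(** * Minimum degree and neighbourhoods *)

Section Degree.
Variables (n k : nat) (G : {set {set 'I_n}}).

Lemma mindeg_le_deg (S : {set 'I_n}) : #|S| = k.-1 -> mindeg k G <= deg G S.
Proof.
move=> /eqP cS; rewrite /mindeg; move: (mem_index_enum S).
elim: (index_enum _) => [//|A r IHr]; rewrite inE big_cons => /orP[/eqP<-|Sr].
  by rewrite cS geq_minl.
by case: ifP => _; [apply: leq_trans (geq_minr _ _) (IHr Sr) | apply: IHr].
Qed.

Hypothesis k0 : 0 < k.
Hypothesis Gk : forall e, e \in G -> #|e| = k.

Lemma deg_le_nbr (S : {set 'I_n}) : #|S| = k.-1 -> deg G S <= #|nbr G S|.
Proof.
move=> cS; apply: leq_trans (leq_imset_card (fun v => v |: S) (mem (nbr G S))).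
apply: subset_leq_card; apply/subsetP => e; rewrite inE => /andP[eG Se].
have /cards1P[v ev] : #|e :\: S| == 1.
  by rewrite cardsD (setIidPr Se) (Gk eG) cS; move: k0; clear; nlia.
have eE : e = v |: S.
  by apply/setP => z; move/setP/(_ z): ev (subset_at Se z); rewrite !inE; case: (z \in S) => /=; case: (z \in e); case: (z == v).
by apply/imsetP; exists v; rewrite // inE -eE.
Qed.

End Degree.

(** * From real densities to integer bounds *)

Import Order.TTheory GRing.Theory Num.Theory.
Local Open Scope ring_scope.

Unset Implicit Arguments.

Theorem theorem2p10 (R : realType) (k : nat) (hk : (3 <= k)%N) :
  exists c0 : R, 0 < c0 /\
  forall b c : R, 0 < b < c0 -> 0 < c < c0 ->
  exists n0 : nat, forall n : nat, (n0 <= n)%N -> (k %| n)%N ->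
  forall G : {set {set 'I_n}},
    is_kgraph k G ->
    (mindeg k G)%:R >= (3^-1 + c) * n%:R ->
    ~ has_perfect_matching G ->
    exists (V1 V2 : {set 'I_n}) (a : bool),
      [/\ V1 :&: V2 = set0, V1 :|: V2 = [set: 'I_n],
          (mindeg k G <= #|V1|)%N, (mindeg k G <= #|V2|)%N &
          (#|[set e in G | odd #|e :&: V1| != a]|%:R <= b * n%:R ^+ k)].
Proof.
exists 1; split=> // b c /andP[b0 _] /andP[c0 _].
(* [K] exceeds [1/(3c)], so [1/3 + c] is at least [(K + 1)/(3K)]. *)
pose K := Num.bound (3 * c)^-1.
have c3 : 0 < 3 * c by rewrite mulr_gt0.
have Kc : 1 <= K%:R * (3 * c).
  rewrite -ler_pdivrMr // mul1r ltW // archi_boundP // invr_ge0 ltW //.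
have K0 : (0 < K)%N.
  by rewrite lt0n; apply/eqP => K0; move: Kc; rewrite K0 mul0r ler10.
have [n0 h] := perfect_or_parity_large hk K0.
exists n0 => n nn kn G /forall_inP kG dG noPM.
have Gk e : e \in G -> #|e| = k by move=> /kG/eqP.
have GD (W : {set 'I_n}) : #|W| = k.-1 -> (mindeg k G <= #|nbr G W|)%N.
  move=> cW; apply: leq_trans (mindeg_le_deg G cW) (deg_le_nbr _ Gk cW).
  exact: leq_trans hk.
have KD : (K.+1 * n <= 3 * K * mindeg k G)%N.
  rewrite -(ler_nat R) !natrM -natr1.
  have : 3 * K%:R * ((3^-1 + c) * n%:R) <= 3 * K%:R * (mindeg k G)%:R :> R.
    by rewrite ler_wpM2l // mulr_ge0.
  apply: le_trans; rewrite mulrA ler_wpM2r // mulrDr mulrAC divff ?mul1r ?pnatr_eq0 //.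
  by rewrite lerD2l mulrAC mulrC.
have := h 'I_n G (mindeg k G); rewrite card_ord => /(_ nn kn Gk GD KD) [|[V [a [Ga D1 D2]]]].
  by case/existsP => M hM; case: noPM; exists M; rewrite /perfect_matching -andbA.
exists V, (~: V), a; split; rewrite ?setICr ?setUCr //.
(* Every edge has parity [a], so there are no exceptional edges to count. *)
have -> : [set e in G | odd #|e :&: V| != a] = set0.
  by apply/setP => e; rewrite !inE; apply/negP => /andP[/Ga ->]; rewrite eqxx.
by rewrite cards0 mulr_ge0 ?exprn_ge0 // ltW.
Qed.
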